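(* Consider the step system given by potentials $V_1,V_2$ and wall positions $q_1^{wall},q_2^{wall}$ with $q_1^{wall}q_2^{wall}\neq 0$. Then the step system is not a Liouville-integrable Hamiltonian impact system. Moreover, for every $h>h^{step}$: (1) for every $(e_1,e_2)=(e_1,h-e_1)\in\mathcal{R}^c(h)$, the step flow on the level set $(e_1,h-e_1)$ is topologically conjugate to the $(\omega_1(e_1),\omega_2(h-e_1))$-directional billiard flow on the L-shaped billiard $L(\pi,\pi,\theta_1^{wall}(e_1;q_1^{wall}),\theta_2^{wall}(h-e_1;q_2^{wall}))$; (2) for every iso-energy level set $(e_1,h-e_1)$ belonging to the complement of $\mathcal{R}^c(h)$, the step flow on the level set is topologically conjugate to a directional billiard flow on a rectangular billiard; (3) both families of level sets (those in $\mathcal{R}^c(h)$ and those in its iso-energy complement) have positive measure.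
   Context: Smooth system. $H=H_1(q_1,p_1)+H_2(q_2,p_2)$, $H_i=\frac{p_i^2}{2}+V_i(q_i)$, on $\mathbb{R}^2\times\mathbb{R}^2$, where each $V_i:\mathbb{R}\to\mathbb{R}$ is $C^\infty$, has a single simple minimum at $0$, $V_i(0)=0$, $qV_i'(q)>0$ for all $q\ne0$, and $V_i(q)\to\infty$ as $|q|\to\infty$. For $e_i>0$ let $q_i^{min}(e_i)<0<q_i^{max}(e_i)$ be the two solutions of $V_i(q)=e_i$, let $T_i(e_i)$ be the period of the orbit $H_i=e_i$ and $\omega_i(e_i)=2\pi/T_i(e_i)$. Step and step flow. $S=\{(q_1,q_2): q_1<q_1^{wall}\text{ and }q_2<q_2^{wall}\}$ with $q_1^{wall}q_2^{wall}\neq0$. The step system is the Hamiltonian flow of $H$ on $(q_1,q_2)\in\mathbb{R}^2\setminus S$ with elastic reflections: on the 1-boundary ($q_1=q_1^{wall}$, $q_2<q_2^{wall}$) $p_1\to-p_1$, and on the 2-boundary ($q_1<q_1^{wall}$, $q_2=q_2^{wall}$) $p_2\to-p_2$; trajectories reaching the corner of the step stop there. The energies $e_i=H_i$ are conserved. The level set $(e_1,e_2)$ is the set of points with $q\in\mathbb{R}^2\setminus S$ and $H_i(q_i,p_i)=e_i$, $i=1,2$, with boundary points glued by the impact rule. Energies. $h_i^{step}=V_i(q_i^{wall})$, $h^{step}=h_1^{step}+h_2^{step}$. For $h>h^{step}$, $\mathcal{R}^c(h)=\{(e_1,e_2): e_1\in(h_1^{step},h-h_2^{step}),\ e_2=h-e_1\}$.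 The iso-energy complement of $\mathcal{R}^c(h)$ consists of the level sets $(e_1,h-e_1)$ with $e_1\in(0,h_1^{step})\cup(h-h_2^{step},h)$. ''Positive measure'' for a family means that its set of $e_1$ values has positive length and the corresponding level sets meet the allowed region of motion in positive area, so that the family occupies positive measure in the energy surface. Wall angles. For $e_i>h_i^{step}$, $\tilde T_i(e_i;q_i^{wall})=2\int_{q_i^{wall}}^{q_i^{max}(e_i)}\frac{dq}{\sqrt{2(e_i-V_i(q))}}$ and $\theta_i^{wall}(e_i;q_i^{wall})=\pi\,\tilde T_i(e_i;q_i^{wall})/T_i(e_i)$. Billiards. $L(\pi,\pi,a,b)$, $0<a,b<\pi$, is the L-shaped table $\{(x_1,x_2)\in[0,\pi]^2: x_1\le a\text{ or }x_2\le b\}$ (vertical arm of width $a$, horizontal arm of height $b$). The $(\omega_1,\omega_2)$-directional billiard flow on a table with horizontal and vertical sides is the motion with velocities in $\{(\pm\omega_1,\pm\omega_2)\}$, with elastic reflection at the sides (vertical sides flip the first velocity component, horizontal sides the second); orbits reaching the reentrant corner stop. Liouville-integrable HIS (LIHIS). A Hamiltonian impact system (smooth Hamiltonian motion in a domain with piecewise smooth boundary, with elastic impacts at the boundary) with compact level sets is Liouville-integrable if: (RespF) all the integrals of motion of the smooth Liouville-integrable Hamiltonian flow are preserved under impacts; and (Resp$\theta$) the motion on any connected component of a regular level set (a component in the allowed region of motion on which the differentials of the constants of motion are independent) is conjugated to a directed motion on a torus. *)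

(* Defs.v *)
From HB Require Import structures.
From mathcomp Require Import all_boot all_order all_algebra generic_quotient.
From mathcomp Require Import all_classical all_reals all_analysis.
Set Implicit Arguments.
Unset Strict Implicit.
Unset Printing Implicit Defensive.
Import Order.TTheory GRing.Theory Num.Theory.
Import numFieldNormedType.Exports.
Local Open Scope classical_set_scope.
Local Open Scope ring_scope.
Local Open Scope quotient_scope.

Section OneDegreeOfFreedom.
Context {R : realType}.
Implicit Types (V : R -> R) (e : R).

Definition smooth V := forall n x, derivable (derive1n n V) x 1.

(* [simple] minimum: the critical point 0 is nondegenerate, i.e. V''(0) > 0. *)
Definition confining_potential V :=
  [/\ smooth V,
      V 0 = 0,
      (forall q, q != 0 -> V 0 < V q) /\ 0 < derive1n 2 V 0,
      (forall q, q != 0 -> 0 < q * derive1 V q) &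
      V q @[q --> +oo] --> +oo /\ V q @[q --> -oo] --> +oo].

Definition energy V (z : R * R) : R := z.2 ^+ 2 / 2 + V z.1.

Definition hamiltonian_solution V (q p : R -> R) :=
  forall t : R, is_derive t (1 : R) q (p t) /\
    is_derive t (1 : R) p (- derive1 V (q t)).

(* The least positive period of the orbit of energy [e]; for the potentials
   considered here the infimum is attained. *)
Definition period V e : R :=
  inf [set T | 0 < T /\ exists q p, [/\ hamiltonian_solution V q p,
         energy V (q 0, p 0) = e
       & forall t, q (t + T) = q t /\ p (t + T) = p t]].

Definition omega V e : R := 2 * pi / period V e.

Definition qmax V e : R := get [set q | 0 < q /\ V q = e].

Definition wall_period V qw e : R :=
  2 * \int[lebesgue_measure]_(q in `[qw, qmax V e])
        (Num.sqrt (2 * (e - V q)))^-1.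

Definition theta_wall V qw e : R := pi * wall_period V qw e / period V e.

End OneDegreeOfFreedom.

(* A phase point ((q1, p1), (q2, p2)). For billiards, p is the velocity. *)
Notation phase R := ((R * R) * (R * R))%type.

Definition position (R : realType) (z : phase R) : R * R := (z.1.1, z.2.1).

(* Motion under H = H_1(q1, p1) + H_2(q2, p2) with H_i = p_i^2 / 2 + V_i(q_i),
   in a domain whose boundary consists of sides parallel to the axes.  An
   elastic impact with a point of [vsides] (q1 constant along the side) flips
   p1, with a point of [hsides] (q2 constant) flips p2.  Motion stops at the
   points of [stops].  A billiard is the case V_1 = V_2 = 0. *)
Record impact_system (R : realType) := ImpactSystem {
  pot1 : R -> R;
  pot2 : R -> R;
  region : set (R * R);
  vsides : set (R * R);
  hsides : set (R * R);
  stops : set (R * R)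
}.

(* The impact rule, as an equivalence relation.  At a point on both kinds of
   sides all four sign choices are identified. *)
Definition impact_rule (R : realType) (M : impact_system R) (z z' : phase R) :=
  [/\ position z = position z',
      z.1.2 = z'.1.2 \/ (vsides M (position z) /\ z.1.2 = - z'.1.2)
    & z.2.2 = z'.2.2 \/ (hsides M (position z) /\ z.2.2 = - z'.2.2)].

Definition impact_rel (R : realType) (M : impact_system R) : rel (phase R) :=
  fun z z' => `[< impact_rule M z z' >].

Section ImpactRelEquiv.
Context {R : realType} (M : impact_system R).

Lemma impact_rel_refl : reflexive (impact_rel M).
Proof. by move=> z; apply/asboolP; split => //; left. Qed.

Lemma impact_rel_sym : symmetric (impact_rel M).
Proof.
have H z z' : impact_rule M z z' -> impact_rule M z' z.
  move=> [e h1 h2]; split; first exact: esym.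
  - by case: h1 => [->|[w ->]]; [left|right; rewrite -e opprK].
  - by case: h2 => [->|[w ->]]; [left|right; rewrite -e opprK].
by move=> z z'; apply/asboolP/asboolP; exact: H.
Qed.

Lemma impact_rel_trans : transitive (impact_rel M).
Proof.
move=> y x z /asboolP[e1 a1 b1] /asboolP[e2 a2 b2]; apply/asboolP; split.
- exact: etrans e2.
- case: a1 => [->|[w ->]]; first by rewrite e1.
  by case: a2 => [->|[_ ->]]; [right|left; rewrite opprK].
- case: b1 => [->|[w ->]]; first by rewrite e1.
  by case: b2 => [->|[_ ->]]; [right|left; rewrite opprK].
Qed.

Canonical impact_equiv_rel :=
  EquivRel (impact_rel M) impact_rel_refl impact_rel_sym impact_rel_trans.

End ImpactRelEquiv.

Definition glued (R : realType) (M : impact_system R) : topologicalType :=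
  quotient_topology {eq_quot impact_rel M}.

Definition to_glued (R : realType) (M : impact_system R) (z : phase R) : glued M :=
  \pi_({eq_quot impact_rel M}) z.

Section ImpactFlow.
Context {R : realType} (M : impact_system R).

Definition free_motion (z : phase R) (t : R) (z' : phase R) :=
  0 <= t /\ exists q1 p1 q2 p2 : R -> R,
    [/\ hamiltonian_solution (pot1 M) q1 p1 /\
          hamiltonian_solution (pot2 M) q2 p2,
        z = ((q1 0, p1 0), (q2 0, p2 0)) /\ z' = ((q1 t, p1 t), (q2 t, p2 t)),
        forall s, 0 <= s <= t -> region M (q1 s, q2 s)
      & forall s, 0 < s < t ->
          ~ (vsides M `|` hsides M `|` stops M) (q1 s, q2 s)].

(* Since [impact_rule] is reflexive, this includes passing through a
   boundary point without change of momentum, as at a grazing contact. *)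
Inductive impact_flow : phase R -> R -> phase R -> Prop :=
| flow_free z t z' : free_motion z t z' -> impact_flow z t z'
| flow_impact z t z1 z2 s z' :
    impact_flow z t z1 -> ~ stops M (position z1) ->
    impact_rule M z1 z2 -> free_motion z2 s z' -> impact_flow z (t + s) z'.

(* [glued_flow x t y]: an orbit leads from x to y in time t >= 0.  No orbit
   passes through a stop point at an intermediate time; it may start or end
   there, so both the orbits running into a stop point and those issuing from
   it are recorded. *)
Definition glued_flow (x : glued M) (t : R) (y : glued M) :=
  exists z z', [/\ to_glued M z = x, to_glued M z' = y & impact_flow z t z'].

End ImpactFlow.
Arguments glued_flow {R} M.

Definition topologically_conjugate (R : realType) (X Y : topologicalType)
    (A : set X) (phi : X -> R -> X -> Prop)
    (B : set Y) (psi : Y -> R -> Y -> Prop) :=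
  exists (f : X -> Y) (g : Y -> X),
    [/\ set_fun A B f /\ set_fun B A g,
        {in A, cancel f g} /\ {in B, cancel g f},
        {within A, continuous f} /\ {within B, continuous g}
      & forall x t y, A x -> A y -> (phi x t y <-> psi (f x) t (f y))].

Section LiouvilleIntegrable.
Context {R : realType}.

Definition level_set (M : impact_system R) (F1 F2 : phase R -> R) (c1 c2 : R) :
    set (glued M) :=
  [set to_glued M z | z in
    [set z | [/\ region M (position z), F1 z = c1 & F2 z = c2]]].
Arguments level_set M F1 F2 c1 c2 : clear implicits.

Definition torus_point (a : R * R) : (R * R) * (R * R) :=
  ((cos a.1, sin a.1), (cos a.2, sin a.2)).

Definition torus : set ((R * R) * (R * R)) := range torus_point.

Definition directed_motion (w1 w2 : R) (u : (R * R) * (R * R)) (t : R)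
    (u' : (R * R) * (R * R)) :=
  0 <= t /\ exists a : R * R,
    u = torus_point a /\ u' = torus_point (a.1 + t * w1, a.2 + t * w2).

Definition independent_differentials (F1 F2 : phase R -> R) (z : phase R) :=
  forall a b : R, (forall v, a * 'd F1 z v + b * 'd F2 z v = 0) ->
    a = 0 /\ b = 0.

Definition RespF (M : impact_system R) (F1 F2 : phase R -> R) :=
  forall z z', region M (position z) -> impact_rule M z z' ->
    F1 z = F1 z' /\ F2 z = F2 z'.

Definition RespTheta (M : impact_system R) (F1 F2 : phase R -> R) :=
  forall (c1 c2 : R) (x : glued M), level_set M F1 F2 c1 c2 x ->
  let C := connected_component (level_set M F1 F2 c1 c2) x in
  (forall z, C (to_glued M z) -> independent_differentials F1 F2 z) ->
  exists w1 w2 : R,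
    topologically_conjugate C (glued_flow M) torus (directed_motion w1 w2).

(* F1, F2 are the constants of motion of the Liouville-integrable smooth flow;
   meant for systems all of whose level sets are compact. *)
Definition LIHIS (M : impact_system R) (F1 F2 : phase R -> R) :=
  RespF M F1 F2 /\ RespTheta M F1 F2.

End LiouvilleIntegrable.
Arguments level_set {R} M F1 F2 c1 c2.

Section Step.
Context {R : realType} (V1 V2 : R -> R) (q1w q2w : R).

Definition step : set (R * R) := [set q | q.1 < q1w /\ q.2 < q2w].

(* The sides are taken closed, so that all velocities at the corner are
   identified, as in the limit along the sides. *)
Definition step_system : impact_system R := {|
  pot1 := V1;
  pot2 := V2;
  region := ~` step;
  vsides := [set q | q.1 = q1w /\ q.2 <= q2w];
  hsides := [set q | q.1 <= q1w /\ q.2 = q2w];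
  stops := [set (q1w, q2w)] |}.

Definition H1 (z : phase R) : R := energy V1 z.1.
Definition H2 (z : phase R) : R := energy V2 z.2.

Definition step_level_set (e1 e2 : R) : set (glued step_system) :=
  level_set step_system H1 H2 e1 e2.

Definition step_flow : glued step_system -> R -> glued step_system -> Prop :=
  glued_flow step_system.

Definition h1step : R := V1 q1w.
Definition h2step : R := V2 q2w.
Definition hstep : R := h1step + h2step.

(* The values of e1 for the level sets (e1, h - e1) in R^c(h) and in its
   iso-energy complement. *)
Definition Rc (h : R) : set R := `]h1step, (h - h2step)[.
Definition Rc_compl (h : R) : set R := `]0, h1step[ `|` `](h - h2step), h[.

Definition allowed_area (e1 e2 : R) : \bar R :=
  (lebesgue_measure \x lebesgue_measure)%E
    [set position z | z in
      [set z | [/\ (~` step) (position z), H1 z = e1 & H2 z = e2]]].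

Definition positive_measure_family (h : R) (E : set R) :=
  (0 < lebesgue_measure E)%E /\
  forall e1, E e1 -> (0 < allowed_area e1 (h - e1))%E.

End Step.
Arguments step_level_set {R} V1 V2 q1w q2w e1 e2.
Arguments step_flow {R} V1 V2 q1w q2w.

Section Billiards.
Context {R : realType}.

Definition L_billiard (a b : R) : impact_system R := {|
  pot1 := fun=> 0;
  pot2 := fun=> 0;
  region := [set x | [/\ 0 <= x.1 <= pi, 0 <= x.2 <= pi
                       & x.1 <= a \/ x.2 <= b]];
  vsides := [set x | [\/ x.1 = 0, x.1 = pi | x.1 = a /\ b <= x.2]];
  hsides := [set x | [\/ x.2 = 0, x.2 = pi | x.2 = b /\ a <= x.1]];
  stops := [set (a, b)] |}.

Definition rectangular_billiard (a b : R) : impact_system R := {|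
  pot1 := fun=> 0;
  pot2 := fun=> 0;
  region := [set x | 0 <= x.1 <= a /\ 0 <= x.2 <= b];
  vsides := [set x | x.1 = 0 \/ x.1 = a];
  hsides := [set x | x.2 = 0 \/ x.2 = b];
  stops := set0 |}.

(* The phase space of the (w1, w2)-directional flow on a table. *)
Definition directional (M : impact_system R) (w1 w2 : R) : set (glued M) :=
  [set to_glued M z | z in
    [set z | [/\ region M (position z), z.1.2 = w1 \/ z.1.2 = - w1
               & z.2.2 = w2 \/ z.2.2 = - w2]]].
Arguments directional M w1 w2 : clear implicits.

Definition conjugate_to_directional_billiard (X : topologicalType) (A : set X)
    (phi : X -> R -> X -> Prop) (M : impact_system R) (w1 w2 : R) :=
  topologically_conjugate A phi (directional M w1 w2) (glued_flow M).

End Billiards.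
Arguments directional {R} M w1 w2.

(* Main.v *)
Require Import Defs.
From mathcomp Require Import all_boot all_order all_algebra generic_quotient.
From mathcomp Require Import all_classical all_reals all_analysis.
From mathcomp Require Import measurable_realfun ring lra.
Import Order.TTheory GRing.Theory Num.Theory.
Import numFieldNormedType.Exports.
Local Open Scope classical_set_scope.
Local Open Scope ring_scope.
Set Implicit Arguments.
Unset Strict Implicit.
Unset Printing Implicit Defensive.

(** Along an orbit of energy [e > 0] of one degree of freedom, use as coordinate
    the phase: the time elapsed since the right turning point, multiplied by the
    frequency [w].  The orbit is then [x |-> (Q x, P x)] with [Q] even, [P] odd,
    both of period [2 * pi], and [Q] decreases on [[0, pi]] from the right to
    the left turning point ([angle_orbit], [angle_orbit_exists]).  Folding the
    phase onto [[0, pi]] turns the oscillation into motion at the constant speed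
    [w] with elastic reflection at [0] and [pi], so the turning points become
    vertical or horizontal sides of a table.  The quotient defining the wall
    angle compares the time spent to the right of the wall with the period, so
    this angle is the phase at which the orbit meets the wall
    ([orbit_theta_wall]).

    Doing this in both degrees of freedom carries a level set to the directional
    phase space of a table inside [[0, pi]^2] ([level_set_straightening]).
    Since [Q] is decreasing, the exterior of the step becomes
    [{x1 <= a or x2 <= b}] when both energies exceed their walls ([L_table]).
    When one energy is below its wall, that coordinate stays on one side of the
    wall: either the step is never met ([full_table]), or the other coordinate
    is confined by its wall ([floor_table], [side_table]).

    The orbits come from an explicit quadrature.  In the variable
    [u = sign(q) * sqrt(2 * V q)], a C1 diffeomorphism of the line because the
    minimum is nondegenerate, the energy level is the circle
    [u = r * cos b, p = - r * sin b], and [dt = db / u'(q)] has no singularity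
    at the turning points.  Inverting the antiderivative of [1 / u'] along the
    circle gives the orbit.  Gronwall's inequality shows that there are no other
    solutions ([hamiltonian_unique]); this determines the period and allows any
    free motion of the step system to be recognised on the table.

    The step system is not Liouville integrable because of the corner: it
    identifies all four velocities, so different orbits issue from the same point
    ([corner_branches]), while a directed motion on a torus has only one future.
    Finally, the allowed region of every level set in either family contains a
    small rectangle, because at least one of the energies exceeds its wall
    ([allowed_area_gt0]). *)

(** * Calculus on the line *)

Section RealCalculus.
Context {R : realType}.
Implicit Types (f df g : R -> R).

Lemma is_derive_continuous f (l x : R) : is_derive x (1 : R) f l -> {for x, continuous f}.
Proof. by move=> [h _]; exact/differentiable_continuous/derivable1_diffP. Qed.

Lemma MVT_everywhere f df x y : (forall z, is_derive z (1 : R) f (df z)) ->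
  x < y -> exists2 z, x < z < y & f y - f x = df z * (y - x).
Proof.
move=> hf xy; have [|z zxy ->] := @MVT _ f df x y xy (fun z _ => hf z).
- apply: continuous_subspaceT => z; exact: (is_derive_continuous (hf z)).
- by exists z.
Qed.

Lemma derive_gt0_lt f df : (forall x, is_derive x (1 : R) f (df x)) ->
  (forall x, 0 < df x) -> {homo f : x y / x < y}.
Proof.
move=> hf df0 x y xy; have [z _ e] := MVT_everywhere hf xy.
by rewrite -subr_gt0 e mulr_gt0// subr_gt0.
Qed.

Lemma derive_le0_le f df a b : (forall x, is_derive x (1 : R) f (df x)) ->
  (forall x, a <= x -> df x <= 0) -> a <= b -> f b <= f a.
Proof.
move=> hf df0; rewrite le_eqVlt => /predU1P[->//|ab].
have [z /andP[az _] e] := MVT_everywhere hf ab.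
by rewrite -subr_le0 e mulr_le0_ge0 ?df0 ?subr_ge0 ?ltW.
Qed.

(** The quantity [exp (- K * t) * D t] is nonincreasing, nonnegative, and zero
    at the origin. *)
Lemma gronwall_zero (D dD : R -> R) (K : R) :
  (forall t, is_derive t (1 : R) D (dD t)) -> (forall t, 0 <= t -> dD t <= K * D t) ->
  (forall t, 0 <= D t) -> D 0 = 0 -> forall t, 0 <= t -> D t = 0.
Proof.
move=> hD DK D0 D00 t t0; apply/eqP; rewrite eq_le D0 andbT.
pose E s := expR (- (K * s)) * D s.
have hE s : is_derive s (1 : R) E (expR (- (K * s)) * (dD s - K * D s)).
  pose h := hD s; rewrite /E.
  apply: is_derive_eq; rewrite /GRing.scale/= ; ring.
have : E t <= E 0.
  apply: (derive_le0_le hE) => // s s0.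
  by rewrite pmulr_rle0 ?expR_gt0// subr_le0 DK.
by rewrite /E D00 mulr0 pmulr_rle0 ?expR_gt0.
Qed.

Lemma bijective_unbounded_increasing f df : (forall x, is_derive x (1 : R) f (df x)) ->
  (forall x, 0 < df x) -> (forall y, exists x, y <= f x) ->
  (forall y, exists x, f x <= y) ->
  exists g, [/\ cancel f g, cancel g f & forall x, is_derive (f x) (1 : R) g (df x)^-1].
Proof.
move=> hf df0 fy fNy.
have fi := derive_gt0_lt hf df0.
have cf : continuous f by move=> x; exact: (is_derive_continuous (hf x)).
have inj : injective f.
  by move=> x y e; have [/fi|/fi|//] := ltgtP x y; rewrite e ltxx.
have surj y : exists x, f x = y.
  have [a ay] := fNy y; have [b yb] := fy y.
  have ab : a <= b.
    by rewrite leNgt; apply/negP => /fi; rewrite ltNge (le_trans ay yb).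
  have [||c _ <-] := @IVT _ f a b y ab; last by exists c.
  - exact: continuous_subspaceT.
  - by rewrite ge_min le_max ay yb orbT.
have /choice[g gK] := surj.
have fK : cancel f g by move=> x; apply: inj; rewrite gK.
exists g; split => // x; apply: is_derive_inverse => //.
- by near=> z; exact: fK.
- by near=> z; exact: cf.
- by rewrite gt_eqF.
Unshelve. all: by end_near. Qed.

End RealCalculus.

Section Antiderivative.
Context {R : realType}.

Lemma derive_eq_on_segment (F G f : R -> R) (a b : R) : a <= b ->
  (forall x, a <= x <= b -> is_derive x (1 : R) F (f x)) ->
  (forall x, a <= x <= b -> is_derive x (1 : R) G (f x)) ->
  F b - F a = G b - G a.
Proof.
move=> ab hF hG.
have hFG x : a <= x <= b -> is_derive x (1 : R) (fun y => F y - G y) 0.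
  move=> xab; have h1 := hF x xab; have h2 := hG x xab.
  by have := is_deriveB h1 h2; rewrite subrr.
have [||c _] := @MVT_segment _ (fun y => F y - G y) (cst 0) a b ab.
- by move=> x xab; apply: hFG; rewrite !(itvP xab).
- apply: continuous_in_subspaceT => x; rewrite inE/= in_itv/= => xab.
  exact: (is_derive_continuous (hFG x xab)).
- by rewrite /cst mul0r; lra.
Qed.

(** The integrals based at [- n.+1] have the required derivative only to the
    right of their base point.  Normalised to vanish at [0] they agree wherever
    they are defined, and are patched together by choosing [n] from [x]. *)
Lemma continuous_antiderivative (f : R -> R) : continuous f ->
  exists2 F : R -> R, F 0 = 0 & forall x, is_derive x (1 : R) F (f x).
Proof.
move=> cf.
have [I dI] : exists I : nat -> R -> R,
    forall n (x : R), - n.+1%:R < x -> is_derive x (1 : R) (I n) (f x).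
  exists (fun n x => \int[lebesgue_measure]_(t in `[(- n.+1%:R), x]) (f t)) => n x nx.
  have [||dI eI] := @continuous_FTC1_closed R f (- n.+1%:R) x (x + 1) _ _ nx (cf x).
  - by rewrite ltrDl.
  - apply: continuous_compact_integrable; first exact: segment_compact.
    exact: continuous_subspaceT.
  - exact: DeriveDef dI (etrans (esym (derive1E _ _)) eI).
pose F n (x : R) : R := I n x - I n 0.
have dF n (x : R) : - n.+1%:R < x -> is_derive x (1 : R) (F n) (f x).
  move=> nx; have h := dI n x nx; have c := is_derive_cst (I n 0) x (1 : R).
  by have := is_deriveB h c; rewrite subr0.
have F0 n : F n 0 = 0 by rewrite /F subrr.
have agree n m (x : R) : (n <= m)%N -> - n.+1%:R < x -> F n x = F m x.
  move=> nm nx.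
  have mn : - m.+1%:R <= - n.+1%:R :> R by rewrite lerN2 ler_nat.
  have n0 : - n.+1%:R < 0 :> R by rewrite oppr_lt0 ltr0n.
  have [x0|/ltW x0] := leP 0 x.
    have := @derive_eq_on_segment (F n) (F m) f 0 x x0.
    rewrite !F0 !subr0; apply => y /andP[y0 yx]; apply: dF; first lra.
    by rewrite (le_lt_trans mn)//; lra.
  have := @derive_eq_on_segment (F n) (F m) f x 0 x0.
  rewrite !F0 !sub0r => H; apply: oppr_inj; apply: H => y /andP[y0 yx].
    by apply: dF; lra.
  by apply: dF; rewrite (le_lt_trans mn)//; lra.
exists (fun x => F (Num.truncn `|x|) x) => // x.
pose N := (Num.truncn (`|x| + 1)).
have bnd (y : R) : - (Num.truncn `|y|).+1%:R < y.
  rewrite ltrNl (le_lt_trans (ler_norm _))// normrN.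
  exact: truncnS_gt.
apply: (@near_eq_is_derive _ _ _ (F N)); last first.
  apply: dF; rewrite ltrNl (le_lt_trans (ler_norm _))// normrN /N.
  by rewrite (le_lt_trans _ (truncnS_gt _)) // lerDl.
near=> y; apply/esym/agree => //.
apply: le_truncn.
by near: y; apply: (cvgr_le _ (@norm_continuous _ R x)); rewrite ltrDl.
Unshelve. all: by end_near. Qed.

End Antiderivative.

(** * The shape of a confining potential *)

Section Potential.
Context {R : realType} (V : R -> R).
Hypothesis hV : confining_potential V.
Local Notation dV := (derive1 V).
Local Notation ddV0 := (derive1n 2 V 0).

Lemma potential_is_derive x : is_derive x (1 : R) V (dV x).
Proof. case: hV => hs *; apply: DeriveDef; [exact: (hs 0%N)|by rewrite derive1E]. Qed.

Lemma force_is_derive x : is_derive x (1 : R) dV (derive1n 2 V x).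
Proof.
by case: hV => hs *; apply: DeriveDef; [exact: (hs 1%N)|rewrite derive1nS derive1E].
Qed.

Lemma potential_continuous : continuous V.
Proof. by move=> x; exact: (is_derive_continuous (potential_is_derive x)). Qed.

Lemma force_continuous : continuous dV.
Proof. by move=> x; exact: (is_derive_continuous (force_is_derive x)). Qed.

Lemma force_derivative_continuous : continuous (derive1n 2 V).
Proof.
case: hV => hs _ _ _ _ x; have h := hs 2%N x.
exact/differentiable_continuous/derivable1_diffP.
Qed.

Lemma force_gt0 x : 0 < x -> 0 < dV x.
Proof. by case: hV => _ _ _ h _ x0; move: (h x); rewrite gt_eqF// pmulr_rgt0//; exact. Qed.

Lemma force_lt0 x : x < 0 -> dV x < 0.
Proof. by case: hV => _ _ _ h _ x0; move: (h x); rewrite lt_eqF// nmulr_rgt0//; exact. Qed.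

Lemma potential0 : V 0 = 0. Proof. by case: hV. Qed.

Lemma potential_gt0 x : x != 0 -> 0 < V x.
Proof. by case: hV => _ V0 [h _] _ _ /h; rewrite V0. Qed.

Lemma potential_ge0 x : 0 <= V x.
Proof. by have [->|/potential_gt0/ltW//] := eqVneq x 0; rewrite potential0. Qed.

Lemma potential_lt_pos x y : 0 <= x -> x < y -> V x < V y.
Proof.
move=> x0 xy; have [z /andP[xz _] e] := MVT_everywhere potential_is_derive xy.
by rewrite -subr_gt0 e mulr_gt0 ?subr_gt0// force_gt0 ?(le_lt_trans x0).
Qed.

Lemma potential_lt_neg x y : y <= 0 -> x < y -> V y < V x.
Proof.
move=> y0 xy; have [z /andP[_ zy] e] := MVT_everywhere potential_is_derive xy.
by rewrite -subr_lt0 e pmulr_llt0 ?subr_gt0// force_lt0 ?(lt_le_trans zy).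
Qed.

Lemma potential_unbounded_pos e : exists2 x, 0 < x & e <= V x.
Proof.
case: hV => _ _ _ _ [/cvgryPge/(_ e) h _].
have [M [_ hM]] : \forall x \near +oo, 0 < x /\ e <= V x.
  by near=> x; split; near: x => //; exact: nbhs_pinfty_gt.
have [] := hM (M + 1); first by rewrite ltrDl.
by exists (M + 1).
Unshelve. all: by end_near. Qed.

Lemma potential_unbounded_neg e : exists2 x, x < 0 & e <= V x.
Proof.
case: hV => _ _ _ _ [_ /cvgryPge/(_ e) h].
have [M [_ hM]] : \forall x \near -oo, x < 0 /\ e <= V x.
  by near=> x; split; near: x => //; exact: nbhs_ninfty_lt.
have [] := hM (M - 1); first by rewrite ltrBlDr ltrDl.
by exists (M - 1).
Unshelve. all: by end_near. Qed.

Lemma force0 : dV 0 = 0.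
Proof.
apply/eqP; rewrite eq_le; apply/andP; split; rewrite leNgt; apply/negP => h.
  have /nbhs_ballP[d /= d0 hd] : \forall x \near (0 : R), 0 < dV x.
    by apply: (cvgr_gt _ (@force_continuous 0)).
  have := hd (- (d / 2)); rewrite /ball/= sub0r opprK gtr0_norm ?divr_gt0//.
  have /force_lt0 : - (d / 2) < 0 by lra.
  by move=> h1 /(_ _)/ltW; rewrite leNgt h1 => H; have : d / 2 < d by [lra]; move/H.
have /nbhs_ballP[d /= d0 hd] : \forall x \near (0 : R), dV x < 0.
  by apply: (cvgr_lt _ (@force_continuous 0)).
have := hd (d / 2); rewrite /ball/= sub0r normrN gtr0_norm ?divr_gt0//.
have /force_gt0 : 0 < d / 2 by lra.
by move=> h1 /(_ _)/ltW; rewrite leNgt h1 => H; have : d / 2 < d by [lra]; move/H.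
Qed.

(** The quotients [V'(x) / x] and [2 * V x / x ^ 2] both extend continuously
    to the minimum by the positive number [V''(0)].  The nondegeneracy of the
    minimum enters the whole development only through this fact. *)
Definition force_ratio x := if x == 0 then ddV0 else dV x / x.
Definition potential_ratio x := if x == 0 then ddV0 else 2 * V x / x ^+ 2.

Lemma ddV0_gt0 : 0 < ddV0. Proof. by case: hV => _ _ []. Qed.

Lemma force_ratio_gt0 x : 0 < force_ratio x.
Proof.
rewrite /force_ratio; case: eqVneq => [_|x0]; first exact: ddV0_gt0.
have [/[dup] h /force_lt0|/[dup] h /force_gt0 h'|e] := ltgtP x 0.
- by rewrite -mulrNN -invrN => h'; rewrite divr_gt0 ?oppr_gt0.
- by rewrite divr_gt0.
- by rewrite e eqxx in x0.
Qed.

Lemma potential_ratio_gt0 x : 0 < potential_ratio x.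
Proof.
rewrite /potential_ratio; case: eqVneq => [_|x0]; first exact: ddV0_gt0.
by rewrite divr_gt0 ?exprn_even_gt0// mulr_gt0// potential_gt0.
Qed.

(** By Caratheodory's form of differentiability, applied to [V'] at [0]. *)
Lemma force_ratio_cvg0 : force_ratio x @[x --> (0 : R)] --> ddV0.
Proof.
have /is_derive1_caratheodory[g [gE cg g0]] := force_is_derive 0.
suff -> : force_ratio = g by rewrite -g0; exact: cg.
apply/funext => x; rewrite /force_ratio; case: eqVneq => [->//|x0].
by have := gE x; rewrite force0 !subr0 => ->; rewrite mulfK.
Qed.

Lemma force_ratio_continuous : continuous force_ratio.
Proof.
move=> x; have [->|x0] := eqVneq x 0.
  rewrite /continuous_at {2}/force_ratio eqxx; exact: force_ratio_cvg0.
have c : {for x, continuous (fun y => dV y / y)}.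
  by apply: cvgM; [exact: force_continuous|exact: cvgV].
rewrite /continuous_at {2}/force_ratio (negPf x0).
apply: cvg_trans c; apply: near_eq_cvg; near=> y.
rewrite /force_ratio ifN//; near: y; exact: (cvgr_neq0 _ cvg_id).
Unshelve. all: by end_near. Qed.

(** Cauchy's mean value theorem for [V] and the square function. *)
Lemma potential_ratioE x : x != 0 ->
  exists2 z, `|z| <= `|x| & potential_ratio x = force_ratio z.
Proof.
move=> x0; pose f y := V y * x ^+ 2 - V x * y ^+ 2.
have hf y : is_derive y (1 : R) f (dV y * x ^+ 2 - V x * (2 * y)).
  pose h := potential_is_derive y; rewrite /f.
  by apply: is_derive_eq; rewrite /GRing.scale/=; ring.
have f0 : f 0 = 0 by rewrite /f potential0; ring.
have fx : f x = 0 by rewrite /f; ring.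
have key z : z != 0 -> `|z| <= `|x| -> dV z * x ^+ 2 - V x * (2 * z) = 0 ->
    exists2 z, `|z| <= `|x| & potential_ratio x = force_ratio z.
  move=> z0 zx e; exists z => //; rewrite /potential_ratio /force_ratio !ifN//.
  have e' : dV z = V x * (2 * z) / x ^+ 2.
    by rewrite -[LHS](mulfK (_ : x ^+ 2 != 0)) ?expf_neq0//; congr (_ / _); lra.
  by rewrite e'; field; rewrite x0 z0.
have [xn|xp|e] := ltgtP x 0; last by rewrite e eqxx in x0.
- have [z /andP[xz z0] e] := MVT_everywhere hf xn.
  apply: (key z); rewrite ?lt_eqF// ?ltr0_norm// ?lerN2 ?ltW//.
  apply: (mulIf (_ : 0 - x != 0)); first by rewrite sub0r oppr_eq0.
  by rewrite -e f0 fx mul0r subrr.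
- have [z /andP[z0 zx] e] := MVT_everywhere hf xp.
  apply: (key z); rewrite ?gt_eqF// ?gtr0_norm// ?ltW//.
  apply: (mulIf (_ : x - 0 != 0)); first by rewrite subr0.
  by rewrite -e f0 fx mul0r subrr.
Qed.

Lemma potential_ratio_continuous : continuous potential_ratio.
Proof.
move=> x; have [->|x0] := eqVneq x 0.
  rewrite /continuous_at {2}/potential_ratio eqxx.
  apply/cvgrPdist_lt => e e0.
  have := force_ratio_cvg0.
  move/cvgrPdist_lt => /(_ e e0)/nbhs_ballP[d /= d0 hd].
  apply/nbhs_ballP; exists d => //= y; rewrite /ball/= sub0r normrN => yd.
  have [->|/potential_ratioE[z zy ->]] := eqVneq y 0.
    by rewrite /potential_ratio eqxx subrr normr0.
  by apply: hd; rewrite /ball/= sub0r normrN (le_lt_trans zy).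
have c : {for x, continuous (fun y => 2 * V y / y ^+ 2)}.
  apply: cvgM; first by apply: cvgM; [exact: cvg_cst|exact: potential_continuous].
  by apply: cvgV; [rewrite expf_neq0|exact: exprn_continuous].
rewrite /continuous_at {2}/potential_ratio (negPf x0).
apply: cvg_trans c; apply: near_eq_cvg; near=> y.
rewrite /potential_ratio ifN//; near: y; exact: (cvgr_neq0 _ cvg_id).
Unshelve. all: by end_near. Qed.

End Potential.

(** * The regularised position *)

Section RegularisedPosition.
Context {R : realType} (V : R -> R).
Hypothesis hV : confining_potential V.
Local Notation dV := (derive1 V).

(** This is [sign(x) * sqrt (2 * V x)].  Writing it as [x] times a continuous
    positive function makes the derivative at [0] immediate, and likewise the
    slope has one formula valid at [0] too. *)
Definition regularised x := x * Num.sqrt (potential_ratio V x).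
Definition regularised_slope x := force_ratio V x / Num.sqrt (potential_ratio V x).

Lemma sqrt_ratio_gt0 x : 0 < Num.sqrt (potential_ratio V x).
Proof. by rewrite sqrtr_gt0 potential_ratio_gt0. Qed.

Lemma regularised_slope_gt0 x : 0 < regularised_slope x.
Proof. by rewrite divr_gt0 ?sqrt_ratio_gt0// force_ratio_gt0. Qed.

Lemma regularised_sqr x : regularised x ^+ 2 = 2 * V x.
Proof.
rewrite /regularised exprMn sqr_sqrtr; last exact/ltW/potential_ratio_gt0.
rewrite /potential_ratio; case: eqVneq => [->|x0].
  by rewrite (potential0 hV) mulr0 expr0n/= mul0r.
by rewrite mulrC divfK// expf_neq0.
Qed.

Lemma regularised_mul_slope x : regularised x * regularised_slope x = dV x.
Proof.
have s0 := sqrt_ratio_gt0 x.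
have -> : regularised x * regularised_slope x = x * force_ratio V x.
  by rewrite /regularised /regularised_slope; field; rewrite gt_eqF.
rewrite /force_ratio; case: eqVneq => [->|x0]; first by rewrite mul0r (force0 hV).
by rewrite mulrC divfK.
Qed.

Lemma sqrt_ratio_continuous : continuous (fun x => Num.sqrt (potential_ratio V x)).
Proof.
move=> x; apply: continuous_comp; last exact: sqrt_continuous.
exact: potential_ratio_continuous.
Qed.

Lemma regularised_slope_continuous : continuous regularised_slope.
Proof.
move=> x; apply: cvgM; first exact: force_ratio_continuous.
apply: cvgV; last exact: sqrt_ratio_continuous.
by rewrite gt_eqF// sqrt_ratio_gt0.
Qed.

Lemma regularised_pos x : 0 < x -> regularised x = Num.sqrt (2 * V x).
Proof.
move=> x0; rewrite -regularised_sqr sqrtr_sqr gtr0_norm//.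
by rewrite mulr_gt0// sqrt_ratio_gt0.
Qed.

Lemma regularised_neg x : x < 0 -> regularised x = - Num.sqrt (2 * V x).
Proof.
move=> x0; rewrite -regularised_sqr sqrtr_sqr ltr0_norm ?opprK//.
by rewrite nmulr_rlt0// sqrt_ratio_gt0.
Qed.

Lemma regularised_is_derive x : is_derive x (1 : R) regularised (regularised_slope x).
Proof.
have root y : y != 0 ->
    is_derive y (1 : R) (fun z => Num.sqrt (2 * V z)) (dV y / Num.sqrt (2 * V y)).
  move=> y0; have V0 : 0 < 2 * V y by rewrite mulr_gt0// potential_gt0.
  have h1 := is_derive1_sqrt V0; pose h2 := potential_is_derive hV y.
  have h3 : is_derive y (1 : R) (fun z => 2 * V z) (2 * dV y).
    by apply: is_derive_eq; rewrite /GRing.scale/=; ring.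
  have := @is_derive1_comp _ Num.sqrt (fun z => 2 * V z) y _ _ h1 h3.
  rewrite (_ : _ * (2 * dV y) = dV y / Num.sqrt (2 * V y))//.
  by field; rewrite gt_eqF// sqrtr_gt0.
have slopeE : regularised_slope x = dV x / regularised x \/ x = 0.
  have [->|x0] := eqVneq x 0; [by right|left].
  rewrite -regularised_mul_slope mulrAC divrr ?mul1r// unitfE.
  by rewrite mulf_neq0// gt_eqF// sqrt_ratio_gt0.
have [x0|x0|x0] := ltgtP x 0.
- case: slopeE => [->|e]; last by rewrite e ltxx in x0.
  rewrite regularised_neg// invrN mulrN.
  apply: (near_eq_is_derive _ (is_deriveN (root _ _))); last by rewrite lt_eqF.
  near=> y; rewrite -[LHS]/(- Num.sqrt (2 * V y)) regularised_neg//; near: y.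
  exact: (cvgr_lt _ cvg_id).
- case: slopeE => [->|e]; last by rewrite e ltxx in x0.
  rewrite regularised_pos//.
  apply: (near_eq_is_derive _ (root _ _)); last by rewrite gt_eqF.
  near=> y; rewrite regularised_pos//; near: y.
  exact: (cvgr_gt _ cvg_id).
- rewrite x0; apply/is_derive1_caratheodory.
  exists (fun x => Num.sqrt (potential_ratio V x)); split.
  + by move=> z; rewrite /regularised mul0r !subr0 mulrC.
  + exact: sqrt_ratio_continuous.
  + rewrite /regularised_slope /force_ratio eqxx /potential_ratio eqxx.
    have s0 : 0 <= derive1n 2 V 0 by apply/ltW; exact: ddV0_gt0.
    rewrite -[X in X / _](sqr_sqrtr s0) expr2 mulfK//.
    by rewrite gt_eqF// sqrtr_gt0 ddV0_gt0.
Unshelve. all: by end_near. Qed.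

Lemma regularised_inverse : exists g, [/\ cancel regularised g, cancel g regularised
  & forall x, is_derive (regularised x) (1 : R) g (regularised_slope x)^-1].
Proof.
apply: (bijective_unbounded_increasing regularised_is_derive).
- exact: regularised_slope_gt0.
- move=> y; have [x x0 e] := potential_unbounded_pos hV (y ^+ 2).
  exists x; rewrite regularised_pos// (le_trans (ler_norm _))//.
  rewrite -sqrtr_sqr ler_sqrt; last by rewrite mulr_ge0// potential_ge0.
  by rewrite (le_trans e)// ler_peMl ?potential_ge0// ler1n.
- move=> y; have [x x0 e] := potential_unbounded_neg hV (y ^+ 2).
  exists x; rewrite regularised_neg// lerNl (le_trans (ler_norm _))// normrN.
  rewrite -sqrtr_sqr ler_sqrt; last by rewrite mulr_ge0// potential_ge0.
  by rewrite (le_trans e)// ler_peMl ?potential_ge0// ler1n.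
Qed.

End RegularisedPosition.

(** * Orbits parametrised by phase *)

Section AngleOrbit.
Context {R : realType}.

(** The periodic orbit of energy [e], as a function of the phase counted from
    the right turning point; [w] is its frequency.  These properties are all
    that the rest of the proof uses about the orbit. *)
Record angle_orbit (V : R -> R) (e w : R) (Q P : R -> R) : Prop := AngleOrbit {
  orbit_freq_gt0 : 0 < w;
  orbit_dQ : forall x, is_derive x (1 : R) Q (P x / w);
  orbit_dP : forall x, is_derive x (1 : R) P (- derive1 V (Q x) / w);
  orbit_energy : forall x, energy V (Q x, P x) = e;
  orbit_even : forall x, Q (- x) = Q x;
  orbit_odd : forall x, P (- x) = - P x;
  orbit_periodQ : forall x, Q (x + 2 * pi) = Q x;
  orbit_periodP : forall x, P (x + 2 * pi) = P x;
  orbit_P_lt0 : forall x, 0 < x < pi -> P x < 0;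
  orbit_onto : forall q p, energy V (q, p) = e ->
    exists x, [/\ 0 <= x <= pi, q = Q x & p = P x \/ p = - P x] }.

(** Solves [beta' = 1 / s (beta)] for an even [2 * pi]-periodic positive [s]:
    [tau] is the time as a function of the angle, and the symmetries of [s] make
    it odd and quasi-periodic. *)
Lemma periodic_antiderivative_inverse (s : R -> R) : continuous s ->
  (forall b, 0 < s b) -> (forall b, s (- b) = s b) ->
  (forall b, s (b + 2 * pi) = s b) ->
  exists tau beta : R -> R,
    [/\ cancel tau beta /\ cancel beta tau,
        (forall t, is_derive t (1 : R) beta (s (beta t))^-1),
        {homo tau : x y / x < y},
        (tau 0 = 0 /\ forall b, tau (- b) = - tau b) &
        forall b, tau (b + 2 * pi) = tau b + 2 * tau pi].
Proof.
move=> cs s0 sN sP.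
have [tau tau0 dtau] := continuous_antiderivative cs.
have tauN b : tau (- b) = - tau b.
  have h x : is_derive x (1 : R) (fun y => tau (- y) + tau y) 0.
    have h1 : is_derive x (1 : R) (tau \o -%R) (s (- x) * -1).
      exact: is_derive1_comp.
    by have := is_deriveD h1 (dtau x); rewrite sN mulrN1 addNr.
  have := is_derive_0_is_cst b 0 h; rewrite oppr0 tau0; lra.
have tauP b : tau (b + 2 * pi) = tau b + tau (2 * pi).
  have h x : is_derive x (1 : R) (fun y => tau (y + 2 * pi) - tau y) 0.
    have h0 : is_derive x (1 : R) (fun y => y + 2 * pi) 1.
      by apply: is_derive_eq; rewrite addr0.
    have h1 : is_derive x (1 : R) (tau \o (fun y => y + 2 * pi)) (s (x + 2 * pi) * 1).
      exact: is_derive1_comp.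
    by have := is_deriveB h1 (dtau x); rewrite sP mulr1 subrr.
  have := is_derive_0_is_cst b 0 h; rewrite add0r tau0; lra.
have tau2pi : tau (2 * pi) = 2 * tau pi.
  have := tauP (- pi); rewrite tauN; rewrite (_ : - pi + 2 * pi = pi); last ring.
  lra.
have tau_lt := derive_gt0_lt dtau s0.
have T0 : 0 < tau (2 * pi) by rewrite -tau0 tau_lt// mulr_gt0// pi_gt0.
have tau_nat n : tau (n%:R * (2 * pi)) = n%:R * tau (2 * pi).
  elim: n => [|n IH]; first by rewrite !mul0r.
  by rewrite -addn1 natrD mulrDl mul1r tauP IH [in RHS]mulrDl mul1r.
have unb y : exists x, y <= tau x.
  exists ((Num.truncn (y / tau (2 * pi))).+1%:R * (2 * pi)).
  by rewrite tau_nat -ler_pdivrMr// ltW// truncnS_gt.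
have unbN y : exists x, tau x <= y.
  by have [x hx] := unb (- y); exists (- x); rewrite tauN lerNl.
have [beta [tauK betaK dbeta]] := bijective_unbounded_increasing dtau s0 unb unbN.
exists tau, beta; split => // [t|b]; last by rewrite tauP tau2pi.
by rewrite -{1}(betaK t); exact: dbeta.
Qed.

(** With [u] the regularised position, the level [e] is the circle
    [u = r * cos b, p = - r * sin b] of radius [r = sqrt (2 * e)].  From
    [u' = slope * p] one gets [b' = slope], so the time is an antiderivative of
    [1 / slope] along the circle, which is smooth across the turning points. *)
Lemma angle_orbit_exists (V : R -> R) (e : R) : confining_potential V -> 0 < e ->
  exists w Q P, angle_orbit V e w Q P.
Proof.
move=> hV e0; pose r := Num.sqrt (2 * e).
have r0 : 0 < r by rewrite sqrtr_gt0; lra.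
have r2 : r ^+ 2 = 2 * e by rewrite sqr_sqrtr//; lra.
have [g [gK Kg dg]] := regularised_inverse hV.
pose s b := (regularised_slope V (g (r * cos b)))^-1.
have cg : continuous g.
  by move=> x; rewrite -(Kg x); apply: is_derive_continuous (dg _).
have slope0 x : 0 < regularised_slope V x by exact: regularised_slope_gt0.
have cs : continuous s.
  move=> b; apply: cvgV; first by rewrite gt_eqF.
  apply: (@continuous_comp _ _ _ (fun b => g (r * cos b)) (regularised_slope V));
    last exact: regularised_slope_continuous.
  apply: (@continuous_comp _ _ _ (fun b => r * cos b) g); last exact: cg.
  by apply: cvgM; [exact: cvg_cst|exact: continuous_cos].
have s0 b : 0 < s b by rewrite invr_gt0.
have sN b : s (- b) = s b by rewrite /s cosN.
have sP b : s (b + 2 * pi) = s b.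
  by rewrite /s (_ : b + 2 * pi = b + pi *+ 2) ?cosD2pi// mulr2n; ring.
have [tau [beta [[tauK betaK] dbeta tau_lt [tau0 tauN] tauP]]] :=
  periodic_antiderivative_inverse cs s0 sN sP.
have pi0 := pi_gt0 R.
have H0 : 0 < tau pi by rewrite -tau0 tau_lt.
have betaN t : beta (- t) = - beta t.
  by rewrite -{1}(betaK t) -tauN tauK.
have betaP t : beta (t + 2 * tau pi) = beta t + 2 * pi.
  by rewrite -{1}(betaK t) -tauP tauK.
have beta_lt x y : x < y -> beta x < beta y.
  move=> xy; rewrite ltNge le_eqVlt; apply/negP => /predU1P[h|/tau_lt].
    by move: xy; rewrite -(betaK x) -h betaK ltxx.
  by rewrite !betaK ltNge (ltW xy).
have beta0 : beta 0 = 0 by rewrite -tau0 tauK.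
(* [tau pi] is half the period. *)
pose w := pi / tau pi.
have w0 : 0 < w by rewrite divr_gt0.
have iw : w^-1 = tau pi / pi by rewrite invf_div.
pose B x := beta (x / w).
have dB x : is_derive x (1 : R) B ((s (B x))^-1 / w).
  have h : is_derive x (1 : R) (fun y => y / w) w^-1.
    by apply: is_derive_eq; rewrite /GRing.scale/=; ring.
  exact: (@is_derive1_comp _ beta (fun y => y / w) x _ _ (dbeta _) h).
have B2pi x : B (x + 2 * pi) = B x + 2 * pi.
  rewrite /B -betaP; congr beta; rewrite mulrDl iw -(mulrA 2); congr (_ + 2 * _).
  by rewrite mulrCA divff ?mulr1// gt_eqF.
pose Q (x : R) := g (r * cos (B x)).
pose P (x : R) := - (r * sin (B x)).
have regQ : forall y, regularised V (Q y) = r * cos (B y).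
  by move=> y; rewrite /Q Kg.
have slopeE : forall y, regularised_slope V (Q y) = (s (B y))^-1.
  by move=> y; rewrite /s invrK.
exists w, Q, P.
split => //.
- move=> x; pose hB := dB x.
  have h : is_derive x (1 : R) (fun y => r * cos (B y)) (P x * ((s (B x))^-1 / w)).
    have h1 := @is_derive1_comp _ cos B x _ _ (is_derive_cos _) hB.
    have := is_deriveZ r h1; rewrite /GRing.scale/=.
    by rewrite (_ : r * _ = P x * ((s (B x))^-1 / w))// /P; ring.
  have hg := dg (Q x); rewrite regQ slopeE in hg.
  have := @is_derive1_comp _ g (fun y => r * cos (B y)) x _ _ hg h.
  rewrite (_ : _ * (P x * _) = P x / w)//.
  by field; rewrite !gt_eqF ?s0.
- move=> x; pose hB := dB x.
  have h1 := @is_derive1_comp _ sin B x _ _ (is_derive_sin _) hB.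
  have := is_deriveN (is_deriveZ r h1); rewrite /GRing.scale/=.
  rewrite (_ : - (r * _) = - derive1 V (Q x) / w)//.
  by rewrite -(regularised_mul_slope hV) regQ slopeE; ring.
- move=> x; rewrite /energy/=.
  have -> : V (Q x) = (r * cos (B x)) ^+ 2 / 2.
    by rewrite -regQ (regularised_sqr hV); field.
  have -> : e = r ^+ 2 / 2 * (cos (B x) ^+ 2 + sin (B x) ^+ 2).
    by rewrite cos2Dsin2 r2; field.
  by rewrite /P; field.
- by move=> x; rewrite /Q /B mulNr betaN cosN.
- by move=> x; rewrite /P /B mulNr betaN sinN mulrN opprK.
- by move=> x; rewrite /Q B2pi (_ : 2 * pi = pi *+ 2) ?cosD2pi// mulr2n; ring.
- by move=> x; rewrite /P B2pi (_ : 2 * pi = pi *+ 2) ?sinD2pi// mulr2n; ring.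
- move=> x /andP[x0 xpi]; rewrite /P oppr_lt0 mulr_gt0// sin_gt0_pi//.
  rewrite /B -beta0 beta_lt ?divr_gt0//= -(tauK pi) beta_lt//.
  by rewrite iw mulrA ltr_pdivrMr// mulrC ltr_pM2l.
- move=> q p; rewrite /energy/= => qp.
  have qp2 : (regularised V q) ^+ 2 + p ^+ 2 = r ^+ 2.
    by rewrite (regularised_sqr hV) r2 -qp; field.
  pose c := regularised V q / r.
  (* The angle of [(q, p)] is [acos c] up to the sign of [p]. *)
  have c2 : 1 - c ^+ 2 = (p / r) ^+ 2.
    have -> : c ^+ 2 = 1 - p ^+ 2 / r ^+ 2.
      rewrite /c exprMn exprVn -[X in X / _](addrK (p ^+ 2)) qp2.
      by field; exact: lt0r_neq0.
    by rewrite exprMn exprVn; ring.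
  have c1 : -1 <= c <= 1.
    by rewrite -ler_norml -(@expr_le1 _ 2)// real_normK ?num_real// -subr_ge0 c2 sqr_ge0.
  have Bc : B (w * tau (acos c)) = acos c.
    by rewrite /B (mulrC w) mulfK ?tauK// gt_eqF.
  exists (w * tau (acos c)); split.
  + rewrite mulr_ge0 ?(ltW w0)//=.
    * rewrite -(divfK (lt0r_neq0 H0) pi) -/w ler_pM2l//.
      have := acos_lepi c1; rewrite le_eqVlt => /predU1P[->//|/tau_lt/ltW//].
    * rewrite -tau0; have := acos_ge0 c1.
      by rewrite le_eqVlt => /predU1P[<-//|/tau_lt/ltW//].
  + by rewrite /Q Bc acosK// /c mulrC divfK ?gt_eqF// gK.
  + rewrite /P Bc sin_acos// c2 sqrtr_sqr normrM normfV (gtr0_norm r0).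
    rewrite mulrC divfK ?gt_eqF//.
    by case: (ger0P p) => _; [right|left]; rewrite opprK.
Qed.

End AngleOrbit.

(** * Uniqueness of solutions *)

Section Uniqueness.
Context {R : realType} (V : R -> R).
Hypothesis hV : confining_potential V.

Lemma sublevel_bounded e : exists a b : R, a < b /\ forall x, V x <= e -> a <= x <= b.
Proof.
have [b b0 hb] := potential_unbounded_pos hV (e + 1).
have [a a0 ha] := potential_unbounded_neg hV (e + 1).
exists a, b; split => [|x xe]; first exact: lt_trans b0.
apply/andP; split; rewrite leNgt; apply/negP => h.
- have := potential_lt_neg hV (ltW a0) h; lra.
- have := potential_lt_pos hV (ltW b0) h; lra.
Qed.

Lemma force_lipschitz (a b : R) : a < b -> exists2 L, 0 <= L &
  forall x y, a <= x <= b -> a <= y <= b ->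
    `|derive1 V x - derive1 V y| <= L * `|x - y|.
Proof.
move=> ab.
have cdd : {within `[a, b], continuous (fun x => `|derive1n 2 V x|)}.
  apply: continuous_subspaceT => x; apply: continuous_comp; last exact: norm_continuous.
  exact: force_derivative_continuous.
have [c _ hc] := EVT_max (ltW ab) cdd.
exists `|derive1n 2 V c| => //.
have main x y : x < y -> a <= x -> y <= b ->
    `|derive1 V x - derive1 V y| <= `|derive1n 2 V c| * `|x - y|.
  move=> xy ax yb; have [z /andP[xz zy] e] := MVT_everywhere (force_is_derive hV) xy.
  rewrite distrC e normrM (distrC x); apply: ler_wpM2r; first exact: normr_ge0.
  apply: hc.
  by rewrite in_itv/= (le_trans ax (ltW xz)) (le_trans (ltW zy) yb).
move=> x y /andP[ax xb] /andP[ay yb]; have [xy|xy|->] := ltgtP x y.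
- exact: main.
- by rewrite distrC [X in _ * X]distrC; exact: main.
- by rewrite !subrr normr0 mulr0.
Qed.

Lemma hamiltonian_energy (q p : R -> R) : hamiltonian_solution V q p ->
  forall t, energy V (q t, p t) = energy V (q 0, p 0).
Proof.
move=> h t; apply: (@is_derive_0_is_cst _ (fun t => energy V (q t, p t))) => x.
have [hq hp] := h x; rewrite /energy/=.
have hc := @is_derive1_comp _ V q x _ _ (potential_is_derive hV _) hq.
have hp2 : is_derive x (1 : R) (fun x => p x ^+ 2 / 2) (p x * - derive1 V (q x)).
  by apply: is_derive_eq; rewrite /GRing.scale/=; field.
have := is_deriveD hp2 hc.
by rewrite mulrN mulrC addNr.
Qed.

(** Both solutions stay in the compact sublevel set of their common energy,
    where the force is Lipschitz, so Gronwall applies to the squared distance. *)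
Lemma hamiltonian_unique (q p q' p' : R -> R) :
  hamiltonian_solution V q p -> hamiltonian_solution V q' p' ->
  q 0 = q' 0 -> p 0 = p' 0 -> forall t, 0 <= t -> q t = q' t /\ p t = p' t.
Proof.
move=> h h' q0 p0.
have [a [b [ab bnd]]] := sublevel_bounded (energy V (q 0, p 0)).
have V_le (x y : R) : V x <= energy V (x, y) by rewrite lerDr mulr_ge0// sqr_ge0.
have bq t : a <= q t <= b by apply: bnd; rewrite -(hamiltonian_energy h t) V_le.
have bq' t : a <= q' t <= b.
  by apply: bnd; rewrite q0 p0 -(hamiltonian_energy h' t) V_le.
have [L L0 lip] := force_lipschitz ab.
pose D t := (q t - q' t) ^+ 2 + (p t - p' t) ^+ 2.
pose dD t := 2 * (q t - q' t) * (p t - p' t)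
           - 2 * (p t - p' t) * (derive1 V (q t) - derive1 V (q' t)).
have hD t : is_derive t (1 : R) D (dD t).
  have [h1 h2] := h t; have [h3 h4] := h' t; rewrite /D.
  by apply: is_derive_eq; rewrite /dD /GRing.scale/=; ring.
have dDle t : 0 <= t -> dD t <= (1 + L) * D t.
  move=> _; have := lip _ _ (bq t) (bq' t); rewrite /dD /D.
  move: (q t - q' t) (p t - p' t) (_ - _) => x y z zx.
  have : - (y * z) <= `|y| * (L * `|x|).
    by rewrite (le_trans (ler_norm _))// normrN normrM ler_wpM2l.
  have := sqr_ge0 (x - y); have := sqr_ge0 (`|x| - `|y|).
  have := mulr_ge0 L0 (sqr_ge0 (`|x| - `|y|)).
  have : `|x| ^+ 2 = x ^+ 2 by rewrite real_normK ?num_real.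
  have : `|y| ^+ 2 = y ^+ 2 by rewrite real_normK ?num_real.
  rewrite !expr2; nra.
have D0 t : 0 <= D t by rewrite addr_ge0// sqr_ge0.
move=> t t0; have : D t = 0.
  by apply: (gronwall_zero hD dDle D0) => //; rewrite /D q0 p0 !subrr expr0n addr0.
move/eqP; rewrite paddr_eq0 ?sqr_ge0// !expf_eq0/= !subr_eq0.
by move=> /andP[/eqP -> /eqP ->].
Qed.

End Uniqueness.

(** * Period and monotonicity of an orbit *)

Section OrbitConsequences.
Context {R : realType} (V : R -> R) (e w : R) (Q P : R -> R).
Hypothesis hV : confining_potential V.
Hypothesis hO : angle_orbit V e w Q P.
Let w0 : 0 < w := orbit_freq_gt0 hO.
Let pi0 : 0 < (pi : R) := pi_gt0 R.

Lemma orbit_P0 : P 0 = 0.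
Proof. have := orbit_odd hO 0; rewrite oppr0; lra. Qed.

Lemma orbit_Ppi : P pi = 0.
Proof.
have := orbit_periodP hO (- pi); rewrite (orbit_odd hO).
rewrite (_ : - pi + 2 * pi = pi); [lra | ring].
Qed.

Lemma orbit_Q_decreasing x y : 0 <= x -> x < y -> y <= pi -> Q y < Q x.
Proof.
move=> x0 xy ypi.
have [z /andP[xz zy] eq] := MVT_everywhere (orbit_dQ hO) xy.
rewrite -subr_lt0 eq pmulr_llt0 ?subr_gt0// pmulr_llt0 ?invr_gt0//.
by apply: (orbit_P_lt0 hO); rewrite (le_lt_trans x0)//= (lt_le_trans zy).
Qed.

Lemma orbit_Q_inj x y : 0 <= x <= pi -> 0 <= y <= pi -> Q x = Q y -> x = y.
Proof.
move=> /andP[x0 xp] /andP[y0 yp] eq.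
have [xy|xy|//] := ltgtP x y.
- by have := orbit_Q_decreasing x0 xy yp; rewrite eq ltxx.
- by have := orbit_Q_decreasing y0 xy xp; rewrite eq ltxx.
Qed.

Lemma orbit_Q_le x y : 0 <= x <= pi -> 0 <= y <= pi -> (Q x <= Q y) = (y <= x).
Proof.
move=> /andP[x0 xp] /andP[y0 yp]; apply/idP/idP => h.
- rewrite leNgt; apply/negP => xy.
  by have := orbit_Q_decreasing x0 xy yp; rewrite ltNge h.
- move: h; rewrite le_eqVlt => /predU1P[->//|yx].
  exact/ltW/orbit_Q_decreasing.
Qed.

Lemma orbit_P_eq0 x : 0 <= x <= pi -> P x = 0 -> x = 0 \/ x = pi.
Proof.
move=> /andP[x0 xp] Px.
have [->|xn0] := eqVneq x 0; first by left.
have [->|xnp] := eqVneq x pi; first by right.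
have : P x < 0 by apply: (orbit_P_lt0 hO); rewrite !lt_def xn0 x0 eq_sym xnp xp.
by rewrite Px ltxx.
Qed.

Lemma orbit_Q_continuous : continuous Q.
Proof. by move=> x; apply: is_derive_continuous (orbit_dQ hO x). Qed.

Lemma orbit_P_continuous : continuous P.
Proof. by move=> x; apply: is_derive_continuous (orbit_dP hO x). Qed.

Lemma orbit_periodQ_nat x n : Q (x + 2 * pi * n%:R) = Q x.
Proof.
elim: n => [|n IH]; first by rewrite mulr0 addr0.
by rewrite -(natr1 n) mulrDr mulr1 addrA (orbit_periodQ hO).
Qed.

Lemma orbit_periodP_nat x n : P (x + 2 * pi * n%:R) = P x.
Proof.
elim: n => [|n IH]; first by rewrite mulr0 addr0.
by rewrite -(natr1 n) mulrDr mulr1 addrA (orbit_periodP hO).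
Qed.

(** The orbit may be run forwards, or, by the symmetry [(Q, P) -> (Q, - P)],
    backwards: the velocity [v] of the phase is [w] or [- w], and [v / w] is the
    sign of the momentum.  This is the form that matches billiard velocities. *)
Lemma orbit_solution x v : v = w \/ v = - w ->
  hamiltonian_solution V (fun t => Q (x + t * v)) (fun t => v / w * P (x + t * v)).
Proof.
move=> hv t; have vv : v * v = w * w by case: hv => ->; rewrite ?mulrNN.
have h : is_derive t (1 : R) (fun s => x + s * v) v.
  by apply: is_derive_eq; rewrite /GRing.scale/=; ring.
split.
- have := @is_derive1_comp _ Q (fun s => x + s * v) t _ _ (orbit_dQ hO _) h.
  by rewrite (_ : _ / w * v = v / w * P (x + t * v))//; ring.
- have := is_deriveZ (v / w)
    (@is_derive1_comp _ P (fun s => x + s * v) t _ _ (orbit_dP hO _) h).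
  rewrite /GRing.scale/= (_ : v / w * _ = - derive1 V (Q (x + t * v)))//.
  rewrite -[RHS]mulr1 (_ : 1 = (v * v) / (w * w)); first by field; rewrite gt_eqF.
  by rewrite vv divff// mulf_neq0// gt_eqF.
Qed.

Lemma orbit_solution_ex (q p : R -> R) : hamiltonian_solution V q p ->
  energy V (q 0, p 0) = e ->
  exists x v, [/\ 0 <= x <= pi, v = w \/ v = - w &
    forall t, 0 <= t -> q t = Q (x + t * v) /\ p t = v / w * P (x + t * v)].
Proof.
move=> h he; have [x [x0 q0 p0]] := orbit_onto hO he.
have [v hv pv] : exists2 v, v = w \/ v = - w & p 0 = v / w * P x.
  have wn0 : w != 0 by rewrite gt_eqF.
  case: p0 => ->; [exists w; rewrite ?divff ?mul1r//|exists (- w)]; [by left|by right|].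
  by rewrite mulNr divff// mulN1r.
exists x, v; split => // t t0.
have := hamiltonian_unique hV h (orbit_solution x hv).
by rewrite !mul0r !addr0; apply.
Qed.

(** A period [T] of some solution of energy [e] is tested at the time when its
    phase is a multiple of [2 * pi].  There [Q] takes its maximum, which it does
    not take again before the phase has advanced by [2 * pi]. *)
Lemma orbit_period : period V e = 2 * pi / w.
Proof.
rewrite /period; set S := [set T | _].
have ST : S (2 * pi / w).
  split; first by rewrite divr_gt0// mulr_gt0.
  exists (fun t => Q (0 + t * w)), (fun t => w / w * P (0 + t * w)).
  split; first by apply: orbit_solution; left.
    by rewrite mul0r add0r divff ?mul1r ?gt_eqF// (orbit_energy hO).
  move=> t; rewrite mulrDl divfK ?gt_eqF// addrA (orbit_periodQ hO).
  by rewrite (orbit_periodP hO).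
have lbS : lbound S (2 * pi / w).
  move=> T [T0 [q [p [h he per]]]]; rewrite leNgt; apply/negP => Tlt.
  have [x [v [/andP[x0 xp] hv sol]]] := orbit_solution_ex h he.
  have Tw : 0 < T * w < 2 * pi by rewrite mulr_gt0//= -ltr_pdivlMr.
  have QT : Q (T * w) = Q 0.
    case: hv => hv.
    - have t0 : 0 <= (2 * pi - x) / w by rewrite divr_ge0 ?(ltW w0)//; lra.
      have [+ _] := sol _ t0; have [+ _] := sol _ (addr_ge0 t0 (ltW T0)).
      rewrite (proj1 (per _)) => -> /=; rewrite hv mulrDl divfK ?gt_eqF//.
      rewrite (_ : x + _ = T * w + 2 * pi); last ring.
      rewrite (_ : x + _ = 0 + 2 * pi); last ring.
      by rewrite !(orbit_periodQ hO).
    - have t0 : 0 <= x / w by rewrite divr_ge0// ltW.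
      have [+ _] := sol _ t0; have [+ _] := sol _ (addr_ge0 t0 (ltW T0)).
      rewrite (proj1 (per _)) => -> /=; rewrite hv mulrDl !mulrN divfK ?gt_eqF//.
      by rewrite addrA subrr add0r (orbit_even hO).
  case/andP: Tw => Tw0 Tw2; have [Twpi|piTw] := leP (T * w) pi.
    by have := orbit_Q_decreasing (lexx 0) Tw0 Twpi; rewrite QT ltxx.
  have : Q (2 * pi - T * w) < Q 0 by apply: orbit_Q_decreasing; lra.
  rewrite (addrC (2 * pi)) (orbit_periodQ hO) (orbit_even hO) QT.
  by rewrite ltxx.
apply/eqP; rewrite eq_le; apply/andP; split.
- by apply: ge_inf => //; exists (2 * pi / w).
- by apply: lb_le_inf => //; exists (2 * pi / w).
Qed.

Lemma orbit_omega : omega V e = w.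
Proof.
rewrite /omega orbit_period invf_div mulrCA divff ?mulr1//.
by rewrite mulf_neq0// gt_eqF.
Qed.

Lemma orbit_V_le x : V (Q x) <= e.
Proof. by rewrite -(orbit_energy hO x) lerDr mulr_ge0// sqr_ge0. Qed.

Lemma orbit_below_wall qw : 0 < qw -> e < V qw -> forall x, Q x < qw.
Proof.
move=> qw0 eV x; rewrite ltNge le_eqVlt; apply/negP => /predU1P[h|h].
- by have := orbit_V_le x; rewrite -h leNgt eV.
- have := potential_lt_pos hV (ltW qw0) h.
  by rewrite ltNge (le_trans (orbit_V_le x) (ltW eV)).
Qed.

Lemma orbit_above_wall qw : qw < 0 -> e < V qw -> forall x, qw < Q x.
Proof.
move=> qw0 eV x; rewrite ltNge le_eqVlt; apply/negP => /predU1P[h|h].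
- by have := orbit_V_le x; rewrite h leNgt eV.
- have := potential_lt_neg hV (ltW qw0) h.
  by rewrite ltNge (le_trans (orbit_V_le x) (ltW eV)).
Qed.

End OrbitConsequences.
Arguments orbit_Q_continuous {R V e w Q P} hO x.

(** * The wall angle is the phase of the wall *)

Section WallAngle.
Context {R : realType} (V : R -> R) (e w : R) (Q P : R -> R).
Hypothesis hV : confining_potential V.
Hypothesis hO : angle_orbit V e w Q P.
Let w0 : 0 < w := orbit_freq_gt0 hO.
Let pi0 : 0 < (pi : R) := pi_gt0 R.

(** Both turning points have potential [e], and [V] is strictly decreasing on
    the negative axis, so the larger one is positive. *)
Lemma orbit_qmax : qmax V e = Q 0.
Proof.
have V0 : V (Q 0) = e.
  by rewrite -(orbit_energy hO 0) /energy/= (orbit_P0 hO) expr0n mul0r add0r.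
have Vpi : V (Q pi) = e.
  by rewrite -(orbit_energy hO pi) /energy/= (orbit_Ppi hO) expr0n mul0r add0r.
have Q0 : 0 < Q 0.
  rewrite ltNge; apply/negP => h.
  have := potential_lt_neg hV h (orbit_Q_decreasing hO (lexx 0) pi0 (lexx _)).
  by rewrite V0 Vpi ltxx.
apply: get_unique => // q [q0 Vq].
have [h|h|//] := ltgtP q (Q 0).
- by have := potential_lt_pos hV (ltW q0) h; rewrite Vq V0 ltxx.
- by have := potential_lt_pos hV (ltW Q0) h; rewrite Vq V0 ltxx.
Qed.

Local Notation mu := (@lebesgue_measure R).
Local Notation slowness := (fun q => (Num.sqrt (2 * (e - V q)))^-1).

Lemma slowness_orbit y : 0 < y < pi -> slowness (Q y) = - (P y)^-1.
Proof.
move=> /(orbit_P_lt0 hO) Py.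
have -> : 2 * (e - V (Q y)) = P y ^+ 2.
  by rewrite -(orbit_energy hO y) /energy/=; field.
by rewrite sqrtr_sqr ltr0_norm// invrN.
Qed.

Lemma slowness_continuous (a b : R) : (forall q, a <= q <= b -> V q < e) ->
  {within `[a, b], continuous slowness}.
Proof.
move=> h; apply: continuous_in_subspaceT => q; rewrite inE/= in_itv/= => /h qe.
apply: cvgV; first by rewrite gt_eqF// sqrtr_gt0 mulr_gt0// subr_gt0.
apply: (@continuous_comp _ _ _ (fun q => 2 * (e - V q)) (@Num.sqrt R));
  last exact: sqrt_continuous.
apply: cvgM; first exact: cvg_cst.
by apply: cvgB; [exact: cvg_cst|exact: potential_continuous].
Qed.

Lemma orbit_V_lt y : 0 < y < pi -> V (Q y) < e.
Proof.
move=> y0; rewrite -(orbit_energy hO y) /energy/= ltrDr divr_gt0//.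
by rewrite exprn_even_gt0//= lt_eqF// (orbit_P_lt0 hO).
Qed.

Lemma orbit_between x y q : 0 < x -> x < y -> y < pi -> Q y <= q <= Q x -> V q < e.
Proof.
move=> x0 xy yp /andP[yq qx].
have hx : 0 < x < pi by rewrite x0 (lt_trans xy).
have hy : 0 < y < pi by rewrite yp (lt_trans x0).
have [q0|q0] := leP 0 q.
- move: qx; rewrite le_eqVlt => /predU1P[->|qx]; first exact: orbit_V_lt.
  by rewrite (lt_trans (potential_lt_pos hV q0 qx))// orbit_V_lt.
- move: yq; rewrite le_eqVlt => /predU1P[<-|yq]; first exact: orbit_V_lt.
  by rewrite (lt_trans (potential_lt_neg hV (ltW q0) yq))// orbit_V_lt.
Qed.

(** Substituting [q = Q z] makes the integrand the constant [1 / w]. *)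
Lemma integral_slowness_inner x y : 0 < x -> x < y -> y < pi ->
  (\int[mu]_(q in `[Q y, Q x]) (slowness q)%:E = ((y - x) / w)%:E)%E.
Proof.
move=> x0 xy yp.
have dQE z : derive1 Q z = P z / w.
  by rewrite derive1E; apply: derive_val; exact: (orbit_dQ hO).
have dQf : derive1 Q = fun z => P z / w by apply/funext.
have cP z : (fun z => P z / w) z @[z --> z] --> P z / w.
  by apply: cvgM; [exact: (orbit_P_continuous hO)|exact: cvg_cst].
have cQ := orbit_Q_continuous hO.
rewrite (@integration_by_substitution_decreasing _ Q slowness x y).
- transitivity (\int[mu]_(z in `[x, y]) (cst w^-1%:E z))%E.
    apply: eq_integral => z; rewrite inE/= in_itv/= => /andP[xz zy].
    have hz : 0 < z < pi by rewrite (lt_le_trans x0)// (le_lt_trans zy).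
    rewrite /cst; congr EFin; rewrite -[LHS]/((Num.sqrt (2 * (e - V (Q z))))^-1 * - (derive1 Q z)).
    rewrite slowness_orbit// dQE mulrNN mulrA mulVf ?mul1r//.
    by rewrite lt_eqF// (orbit_P_lt0 hO).
  rewrite integral_cst//= lebesgue_measure_itv/= lte_fin xy -EFinD -EFinM.
  by congr EFin; rewrite mulrC.
- exact: ltW.
- move=> a b; rewrite !in_itv/= => /andP[xa ay] /andP[xb yb] ab.
  apply: (orbit_Q_decreasing hO) => //; first exact: le_trans (ltW x0) xb.
  exact: le_trans ay (ltW yp).
- by move=> z _; rewrite dQf; exact: cP.
- by rewrite dQf; apply/cvg_ex; exists (P x / w); apply: cvg_at_right_filter; exact: cP.
- by rewrite dQf; apply/cvg_ex; exists (P y / w); apply: cvg_at_left_filter; exact: cP.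
- split.
  + by move=> z _; case: (orbit_dQ hO z).
  + by apply: cvg_at_right_filter; exact: cQ.
  + by apply: cvg_at_left_filter; exact: cQ.
- by apply: slowness_continuous => q; exact: orbit_between.
Qed.

(** The integrand is unbounded at the turning point [Q 0], so the integral is
    the monotone limit of the integrals over [[Q y, Q (y / n.+2)]]. *)
Lemma integral_slowness y : 0 < y -> y < pi ->
  (\int[mu]_(q in `[Q y, Q 0]) (slowness q)%:E = (y / w)%:E)%E.
Proof.
move=> y0 yp; pose eps n := y / n.+2%:R.
have eps0 n : 0 < eps n by rewrite divr_gt0.
have epsy n : eps n < y by rewrite ltr_pdivrMr// ltr_pMr// ltr1n.
have epsS n m : (n <= m)%N -> eps m <= eps n.
  by move=> nm; rewrite ler_pM2l// lef_pV2 ?posrE// ler_nat.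
have cvg_eps : eps n @[n --> \oo] --> 0.
  rewrite -(mulr0 y); apply: cvgM; first exact: cvg_cst.
  by have := @cvg_harmonic R; rewrite -cvg_shiftS.
pose A n := [set` `[Q y, Q (eps n)]].
have bigA : \bigcup_n A n = [set` `[Q y, Q 0[ ].
  apply/seteqP; split => q /=.
    move=> [n _]; rewrite /A/= !in_itv/= => /andP[-> h] /=.
    apply: le_lt_trans h _; apply: (orbit_Q_decreasing hO) => //.
    exact/ltW/(lt_trans (epsy n)).
  rewrite in_itv/= => /andP[yq q0].
  have cQ : Q (eps n) @[n --> \oo] --> Q 0.
    exact: (cvg_comp _ _ cvg_eps (orbit_Q_continuous hO 0)).
  have [n _ hn] := cvgr_gt _ cQ _ q0.
  by exists n => //; rewrite /A/= in_itv/= yq ltW//; exact: (hn n (leqnn n)).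
have nnA : nondecreasing_seq A.
  move=> n m nm; rewrite subsetEset => q; rewrite /A/= !in_itv/= => /andP[-> h] /=.
  apply: le_trans h _; rewrite (orbit_Q_le hO) ?epsS//.
  - by rewrite ltW//= ltW// (lt_trans (epsy n)).
  - by rewrite ltW//= ltW// (lt_trans (epsy m)).
have mA n : measurable (A n) by exact: measurable_itv.
pose F : R -> \bar R := fun q => (slowness q)%:E.
have mF n : measurable_fun (A n) F.
  apply/measurable_EFinP; apply: subspace_continuous_measurable_fun; first exact: mA.
  by apply: slowness_continuous => q; exact: orbit_between.
have F0 n q : A n q -> (0 <= F q)%E.
  by move=> _; rewrite lee_fin invr_ge0 sqrtr_ge0.
have -> : (\int[mu]_(q in `[Q y, Q 0]) (slowness q)%:E = \int[mu]_(q in \bigcup_n A n) F q)%E.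
  rewrite bigA; apply/esym/integral_itv_bndo_bndc.
  by rewrite -bigA; exact/measurable_fun_bigcup.
have lim : (\int[mu]_(q in A n) F q)%E @[n --> \oo] --> (y / w)%:E.
  rewrite (_ : (fun n => _) = fun n => ((y - eps n) / w)%:E); last first.
    by apply/funext => n; rewrite integral_slowness_inner.
  apply: cvg_EFin; first by near=> n.
  rewrite -[X in _ --> X / w]subr0; apply: cvgM; last exact: cvg_cst.
  by apply: cvgB; [exact: cvg_cst|exact: cvg_eps].
have h : ((\int[mu]_(q in A n) F q)%E @[n --> \oo] --> \int[mu]_(q in \bigcup_n A n) F q)%E.
  exact: (@ge0_nondecreasing_set_cvg_integral _ (measurableTypeR R) R A F mu nnA mA mF F0).
exact: (cvg_unique _ h lim).
Unshelve. all: by end_near. Qed.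

Lemma orbit_theta_wall qw : V qw < e ->
  0 < theta_wall V qw e < pi /\ Q (theta_wall V qw e) = qw.
Proof.
move=> qe.
have [x [x01 Qx Px]] : exists x, [/\ 0 <= x <= pi, qw = Q x &
    Num.sqrt (2 * (e - V qw)) = P x \/ Num.sqrt (2 * (e - V qw)) = - P x].
  apply: (orbit_onto hO); rewrite /energy/= sqr_sqrtr; first by field.
  by rewrite mulr_ge0// subr_ge0 ltW.
have Pn0 : P x != 0.
  have : 0 < Num.sqrt (2 * (e - V qw)) by rewrite sqrtr_gt0 mulr_gt0// subr_gt0.
  by case: Px => -> h; rewrite ?(gt_eqF h)// -oppr_eq0 gt_eqF.
have {x01} x01 : 0 < x < pi.
  move: x01; rewrite !le_eqVlt => /andP[/predU1P[x0|->] /predU1P[xp|->]] //.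
  - by move: pi0; rewrite -xp x0 ltxx.
  - by rewrite -x0 (orbit_P0 hO) eqxx in Pn0.
  - by rewrite xp (orbit_Ppi hO) eqxx in Pn0.
suff -> : theta_wall V qw e = x by [].
have /andP[x0 xp] := x01.
rewrite /theta_wall /wall_period orbit_qmax Qx /Rintegral integral_slowness//=.
rewrite (orbit_period hV hO) invf_div.
have := lt0r_neq0 pi0; have := lt0r_neq0 w0; move: (pi : R) => p wn pn.
by field; rewrite wn pn.
Qed.

End WallAngle.

(** * Conjugacies from maps of phase points *)

Section Gluing.
Context {R : realType}.
Implicit Types (M N : impact_system R).

Lemma to_gluedP M z z' : to_glued M z = to_glued M z' <-> impact_rule M z z'.
Proof.
have E := @eqmodP _ (impact_equiv_rel M) z z'.
by split => [/E/asboolP//|h]; apply/E/asboolP.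
Qed.

Lemma closed_glued M (K : set (glued M)) :
  closed K <-> closed (to_glued M @^-1` K).
Proof.
split => h; first by apply: closed_comp => // z _; exact: pi_continuous.
rewrite -openC; have : open (to_glued M @^-1` (~` K)) by rewrite preimage_setC openC.
exact.
Qed.

Lemma impact_rule_sym M z z' : impact_rule M z z' -> impact_rule M z' z.
Proof. by move/to_gluedP/esym/to_gluedP. Qed.

Definition saturated M (A : set (phase R)) :=
  forall z z', A z -> impact_rule M z z' -> A z'.

Lemma saturated_to_glued M (A : set (phase R)) z : saturated M A ->
  (to_glued M @` A) (to_glued M z) -> A z.
Proof. by move=> sA [z' Az' /to_gluedP h]; exact: sA h. Qed.

(** For a quotient topology it is convenient to test continuity on a subset by
    preimages that are closed in the whole space. *)
Lemma closed_within_continuous (X Y : topologicalType) (A : set X) (f : X -> Y) :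
  (forall K, closed K -> closed (f @^-1` K `&` A)) -> {within A, continuous f}.
Proof.
move=> h; apply/continuous_closedP => K /h cK; apply/closed_subspaceP.
by exists (f @^-1` K `&` A) => //; rewrite -setIA setIid.
Qed.

(** A continuous map [G] from a compact set [B] of representatives onto [A],
    which identifies points exactly when the two impact rules do, induces a
    homeomorphism of the glued sets.  Only [G] has to be continuous: the inverse
    is continuous because [G] maps compact sets to compact sets. *)
Lemma conjugate_of_lift M N (A B : set (phase R)) (G : phase R -> phase R) :
  saturated M A -> saturated N B -> compact B -> continuous G ->
  (forall w, B w -> A (G w)) ->
  (forall z, A z -> exists2 w, B w & G w = z) ->
  (forall w w', B w -> B w' -> (impact_rule N w w' <-> impact_rule M (G w) (G w'))) ->
  (forall w t w', B w -> impact_flow N w t w' -> B w' /\ impact_flow M (G w) t (G w')) ->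
  (forall z t z', A z -> impact_flow M z t z' ->
    exists w w', [/\ B w, B w', G w = z, G w' = z' & impact_flow N w t w']) ->
  topologically_conjugate (to_glued M @` A) (glued_flow M)
                          (to_glued N @` B) (glued_flow N).
Proof.
move=> sA sB cB cG GA onto Gr flowN flowM.
have hR : hausdorff_space (phase R) by exact: norm_hausdorff.
have /choice[F FP] : forall z, exists w, A z -> B w /\ G w = z.
  move=> z; have [/onto[w Bw <-]|nA] := pselect (A z); first by exists w.
  by exists z.
pose f (x : glued M) := to_glued N (F (repr x)).
pose g (y : glued N) := to_glued M (G (repr y)).
have piM z : impact_rule M (repr (to_glued M z)) z.
  by apply/to_gluedP; exact: reprK.
have piN z : impact_rule N (repr (to_glued N z)) z.
  by apply/to_gluedP; exact: reprK.
have gE w : B w -> g (to_glued N w) = to_glued M (G w).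
  move=> Bw; apply/to_gluedP; apply/Gr => //.
  by apply: sB (impact_rule_sym (piN w)).
have fE w : B w -> f (to_glued M (G w)) = to_glued N w.
  move=> Bw; have h := piM (G w).
  have Ar := sA _ _ (GA _ Bw) (impact_rule_sym h).
  have [BF GF] := FP _ Ar.
  by apply/to_gluedP/Gr => //; rewrite GF.
have lift x : (to_glued M @` A) x -> exists2 w, B w & x = to_glued M (G w).
  by move=> [z /onto[w Bw <-] <-]; exists w.
exists f, g; split.
- split; first by move=> _ /lift[w Bw ->]; rewrite fE//; exists w.
  by move=> _ [w Bw <-]; rewrite gE//; exists (G w) => //; exact: GA.
- split => x; rewrite inE; first by move=> /lift[w Bw ->]; rewrite fE// gE.
  by move=> [w Bw <-]; rewrite gE// fE.
- split; apply: closed_within_continuous => K /closed_glued cK; apply/closed_glued.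
  + have -> : to_glued M @^-1` (f @^-1` K `&` (to_glued M @` A)) =
              G @` (B `&` to_glued N @^-1` K).
      apply/seteqP; split => z /=.
        move=> [Kz /(saturated_to_glued sA)/onto[w Bw zE]].
        by exists w => //; split => //=; rewrite -fE// zE.
      move=> [w [Bw Kw] <-]; rewrite fE//; split => //.
      by exists (G w) => //; exact: GA.
    apply: compact_closed => //; apply: continuous_compact.
      exact: continuous_subspaceT.
    by apply: (subclosed_compact _ cB) => //; apply: closedI => //; exact: compact_closed.
  + have -> : to_glued N @^-1` (g @^-1` K `&` (to_glued N @` B)) =
              B `&` G @^-1` (to_glued M @^-1` K).
      apply/seteqP; split => w /=.
        by move=> [+ /(saturated_to_glued sB) Bw]; rewrite gE.
      by move=> [Bw Kw]; rewrite gE//; split => //; exists w.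
    apply: closedI; first exact: compact_closed.
    by apply: closed_comp => // w _; exact: cG.
- move=> x t y /lift[w Bw ->] /lift[w' Bw' ->]; rewrite !fE//; split.
  + move=> [z [z' [/to_gluedP hz /to_gluedP hz' zz']]].
    have Az : A z := sA _ _ (GA _ Bw) (impact_rule_sym hz).
    have [v [v' [Bv Bv' Gv Gv' vv']]] := flowM _ _ _ Az zz'.
    exists v, v'; split => //; apply/to_gluedP/Gr => //; by rewrite ?Gv ?Gv'.
  + move=> [v [v' [/to_gluedP hv /to_gluedP hv' vv']]].
    have Bv : B v := sB _ _ Bw (impact_rule_sym hv).
    have [Bv' GG] := flowN _ _ _ Bv vv'.
    by exists (G v), (G v'); split => //; apply/to_gluedP; apply/Gr.
Qed.

End Gluing.

(** * Straight flights and folding of the phase *)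

Section Unfolding.
Context {R : realType}.

(** A relation between times that composes holds as soon as it holds within
    each cell of a grid.  It serves to cut a smooth motion at its turning
    points. *)
Lemma grid_induction (a d : R) (S : R -> R -> Prop) : 0 < d ->
  (forall (k : nat) s s', a + k%:R * d <= s -> s <= s' -> s' <= a + k.+1%:R * d -> S s s') ->
  (forall s u s', s < u -> u < s' -> S s u -> S u s' -> S s s') ->
  forall s s', a <= s -> s <= s' -> S s s'.
Proof.
move=> d0 cell concat s s' as_ ss'.
have [n hn] : exists n : nat, s' <= a + n.+1%:R * d.
  exists (Num.truncn ((s' - a) / d)).
  by rewrite addrC -lerBlDr -ler_pdivrMr// ltW// truncnS_gt.
elim: n s' ss' hn => [|n IH] s' ss' hn; first by apply: (cell 0%N); rewrite ?mul0r ?addr0.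
have [h|h] := leP s' (a + n.+1%:R * d); first exact: IH.
have [h'|h'] := leP (a + n.+1%:R * d) s; first exact: (cell n.+1).
apply: (concat _ (a + n.+1%:R * d)) => //; first by apply: IH => //; exact: ltW.
by apply: (cell n.+1) => //; exact: ltW.
Qed.

Lemma affine_interior (x v b s1 s s2 : R) : v != 0 -> s1 < s -> s < s2 ->
  0 <= x + s1 * v <= b -> 0 <= x + s2 * v <= b -> 0 < x + s * v < b.
Proof.
move=> v0 s1s ss2 /andP[h1 h2] /andP[h3 h4].
have [v_lt|v_gt|ve] := ltgtP v 0; last by rewrite ve eqxx in v0.
- have h5 : s2 * v < s * v by rewrite ltr_nM2r.
  have h6 : s * v < s1 * v by rewrite ltr_nM2r.
  by apply/andP; split; lra.
- have h5 : s * v < s2 * v by rewrite ltr_pM2r.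
  have h6 : s1 * v < s * v by rewrite ltr_pM2r.
  by apply/andP; split; lra.
Qed.

Lemma hamiltonian_solution0 (q p : R -> R) : hamiltonian_solution (fun=> 0) q p ->
  forall t, q t = q 0 + t * p 0 /\ p t = p 0.
Proof.
move=> h.
have pE t : p t = p 0.
  apply: is_derive_0_is_cst => x; have [_] := h x.
  by rewrite derive1_cst oppr0.
move=> t; split => //; apply/eqP; rewrite -subr_eq; apply/eqP.
have d x : is_derive x (1 : R) (fun x => q x - x * p 0) 0.
  have [hq _] := h x; rewrite pE in hq.
  by apply: is_derive_eq; rewrite /GRing.scale/=; ring.
by have := is_derive_0_is_cst t 0 d; rewrite mul0r subr0.
Qed.

Lemma hamiltonian_solution0_affine (x v : R) :
  hamiltonian_solution (fun=> 0) (fun t => x + t * v) (fun=> v).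
Proof.
move=> t; split; first by apply: is_derive_eq; rewrite /GRing.scale/=; ring.
by rewrite derive1_cst oppr0; exact: is_derive_cst.
Qed.

Lemma impact_flow_trans (M : impact_system R) z t z1 z2 s z' :
  impact_flow M z t z1 -> ~ stops M (position z1) -> impact_rule M z1 z2 ->
  impact_flow M z2 s z' -> impact_flow M z (t + s) z'.
Proof.
move=> f1 ns r f2; elim: f2 z1 f1 ns r => [{}z2 {}s {}z' fm z1 f1 ns r|
  {}z2 {}s y1 y2 s' {}z' _ IH ns' r' fm z1 f1 ns r].
  exact: flow_impact ns r fm.
by rewrite addrA; apply: flow_impact ns' r' fm; exact: (IH z1).
Qed.

End Unfolding.

Section Fold.
Context {R : realType} (V : R -> R) (e w : R) (Q P : R -> R).
Hypothesis hV : confining_potential V.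
Hypothesis hO : angle_orbit V e w Q P.

(** Running backwards from the phase [x] is the same as running forwards from
    [- x].  The bound [- pi <= a] makes the grid of turning points start before
    time [0], so that its cells are numbered by natural numbers. *)
Lemma orbit_solution_angle (q p : R -> R) : hamiltonian_solution V q p ->
  energy V (q 0, p 0) = e ->
  exists2 a, - pi <= a & forall t, 0 <= t -> q t = Q (a + t * w) /\ p t = P (a + t * w).
Proof.
move=> h he; have [x [v [/andP[x0 xp] hv sol]]] := orbit_solution_ex hV hO h he.
have w0 := orbit_freq_gt0 hO; have pi0 := pi_gt0 R.
case: hv => hv.
- exists x; first lra.
  by move=> t /sol[-> ->]; rewrite hv divff ?mul1r// gt_eqF.
- exists (- x); first lra.
  move=> t /sol[-> ->]; rewrite hv mulNr divff ?gt_eqF// mulN1r mulrN.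
  rewrite -(orbit_even hO) -(orbit_odd hO) opprB.
  by rewrite (addrC (- x)).
Qed.

(** While the phase is in the cell [[- pi + k * pi, - pi + k.+1 * pi]], its fold
    onto [[0, pi]] is affine in time: it increases if [k] is odd and decreases
    if [k] is even, as [k = 1] is the cell [[0, pi]] itself. *)
Lemma orbit_fold (a : R) (k : nat) : exists x v, (v = w \/ v = - w) /\
  forall s, [/\ Q (a + s * w) = Q (x + s * v), P (a + s * w) = v / w * P (x + s * v) &
    - pi + k%:R * pi <= a + s * w -> a + s * w <= - pi + k.+1%:R * pi ->
    0 <= x + s * v <= pi].
Proof.
have w0 := orbit_freq_gt0 hO.
have kE : k%:R = (odd k)%:R + 2 * (k./2)%:R :> R.
  by rewrite -{1}(odd_double_half k) natrD -mul2n natrM.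
have k1E : k.+1%:R = k%:R + 1 :> R by rewrite -natr1.
case: (odd k) kE => kE.
- exists (a - 2 * pi * (k./2)%:R), w; split; first by left.
  move=> s; have E : a + s * w = a - 2 * pi * (k./2)%:R + s * w + 2 * pi * (k./2)%:R by ring.
  rewrite divff ?gt_eqF// mul1r; split.
  + by rewrite {1}E (orbit_periodQ_nat hO).
  + by rewrite {1}E (orbit_periodP_nat hO).
  + rewrite k1E kE /= => h1 h2; apply/andP; split; lra.
- exists (2 * pi * (k./2)%:R - a), (- w); split; first by right.
  move=> s; have E : a + s * w = - (2 * pi * (k./2)%:R - a + s * - w) + 2 * pi * (k./2)%:R by ring.
  rewrite mulNr divff ?gt_eqF// mulN1r; split.
  + by rewrite {1}E (orbit_periodQ_nat hO) (orbit_even hO).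
  + by rewrite {1}E (orbit_periodP_nat hO) (orbit_odd hO).
  + rewrite k1E kE /= => h1 h2; apply/andP; split; lra.
Qed.

End Fold.

(** * Straightening a level set *)

Lemma continuous_pair (T X Y : topologicalType) (f : T -> X) (g : T -> Y) :
  continuous f -> continuous g -> continuous (fun z => (f z, g z)).
Proof. by move=> cf cg z; apply: cvg_pair; [exact: cf|exact: cg]. Qed.

Section Straightening.
Context {R : realType} (M N : impact_system R) (e1 e2 w1 w2 : R) (Q1 P1 Q2 P2 : R -> R).
Hypothesis hV1 : confining_potential (pot1 M).
Hypothesis hV2 : confining_potential (pot2 M).
Hypothesis hO1 : angle_orbit (pot1 M) e1 w1 Q1 P1.
Hypothesis hO2 : angle_orbit (pot2 M) e2 w2 Q2 P2.
Hypothesis potN : pot1 N = (fun=> 0) /\ pot2 N = (fun=> 0).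
Hypothesis closedM : closed (region M).
Hypothesis regionN : forall x, region N x <->
  [/\ 0 <= x.1 <= pi, 0 <= x.2 <= pi & region M (Q1 x.1, Q2 x.2)].
Hypothesis vsidesN : forall x, region N x ->
  (vsides N x <-> x.1 = 0 \/ x.1 = pi \/ vsides M (Q1 x.1, Q2 x.2)).
Hypothesis hsidesN : forall x, region N x ->
  (hsides N x <-> x.2 = 0 \/ x.2 = pi \/ hsides M (Q1 x.1, Q2 x.2)).
Hypothesis stopsN : forall x, region N x -> (stops N x <-> stops M (Q1 x.1, Q2 x.2)).

Let w10 : 0 < w1 := orbit_freq_gt0 hO1.
Let w20 : 0 < w2 := orbit_freq_gt0 hO2.

Let A := [set z : phase R | [/\ region M (position z),
  H1 (pot1 M) z = e1 & H2 (pot2 M) z = e2]].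
Let B := [set z : phase R | [/\ region N (position z),
  z.1.2 = w1 \/ z.1.2 = - w1 & z.2.2 = w2 \/ z.2.2 = - w2]].

Definition unstraighten (z : phase R) : phase R :=
  ((Q1 z.1.1, z.1.2 / w1 * P1 z.1.1), (Q2 z.2.1, z.2.2 / w2 * P2 z.2.1)).
Local Notation G := unstraighten.

Let saturatedA : saturated M A.
Proof.
move=> z z' [rz ez1 ez2] [pz h1 h2]; split; first by rewrite -pz.
- rewrite -ez1 /H1 /energy; case: pz => -> _.
  by case: h1 => [->//|[_ ->]]; rewrite sqrrN.
- rewrite -ez2 /H2 /energy; case: pz => _ ->.
  by case: h2 => [->//|[_ ->]]; rewrite sqrrN.
Qed.

Let saturatedB : saturated N B.
Proof.
move=> z z' [rz ez1 ez2] [pz h1 h2]; split; first by rewrite -pz.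
- by case: h1 => [<-//|[_ h]]; rewrite h in ez1; case: ez1 => [<-|/oppr_inj->];
    rewrite ?opprK; [right|left].
- by case: h2 => [<-//|[_ h]]; rewrite h in ez2; case: ez2 => [<-|/oppr_inj->];
    rewrite ?opprK; [right|left].
Qed.

Let continuousG : continuous G.
Proof.
have c1 : continuous (fun z : phase R => z.1.1).
  by move=> z; apply: (@continuous_comp _ _ _ fst fst); exact: cvg_fst.
have c2 : continuous (fun z : phase R => z.1.2).
  by move=> z; apply: (@continuous_comp _ _ _ fst snd); [exact: cvg_fst|exact: cvg_snd].
have c3 : continuous (fun z : phase R => z.2.1).
  by move=> z; apply: (@continuous_comp _ _ _ snd fst); [exact: cvg_snd|exact: cvg_fst].
have c4 : continuous (fun z : phase R => z.2.2).
  by move=> z; apply: (@continuous_comp _ _ _ snd snd); exact: cvg_snd.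
have comp (f : R -> R) (g : phase R -> R) :
    continuous f -> continuous g -> continuous (f \o g).
  by move=> cf cg z; apply: continuous_comp; [exact: cg|exact: cf].
have cQ1 := comp _ _ (orbit_Q_continuous hO1) c1.
have cP1 := comp _ _ (orbit_P_continuous hO1) c1.
have cQ2 := comp _ _ (orbit_Q_continuous hO2) c3.
have cP2 := comp _ _ (orbit_P_continuous hO2) c3.
apply: continuous_pair; apply: continuous_pair.
- exact: cQ1.
- move=> z; apply: cvgM; last exact: cP1.
  by apply: cvgM; [exact: c2|exact: cvg_cst].
- exact: cQ2.
- move=> z; apply: cvgM; last exact: cP2.
  by apply: cvgM; [exact: c4|exact: cvg_cst].
Qed.

(** The region of the table is the part of the square [[0, pi]^2] whose image
    is allowed, hence closed. *)
Let compactB : compact B.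
Proof.
have two_points (v : R) : compact [set x : R | x = v \/ x = - v].
  have -> : [set x : R | x = v \/ x = - v] = [set v] `|` [set - v] by [].
  by apply: compactU; exact: compact_set1.
have box : compact ((`[0, (pi : R)]%classic `*` [set x : R | x = w1 \/ x = - w1])
   `*` (`[0, (pi : R)]%classic `*` [set x : R | x = w2 \/ x = - w2])).
  by apply: compact_setX; apply: compact_setX => //; exact: segment_compact.
have -> : B = ((`[0, (pi : R)]%classic `*` [set x : R | x = w1 \/ x = - w1])
   `*` (`[0, (pi : R)]%classic `*` [set x : R | x = w2 \/ x = - w2]))
   `&` ((fun z => position (G z)) @^-1` region M).
  apply/seteqP; split => -[[x1 v1] [x2 v2]] /=.
    by rewrite /B/= /position/= => -[/regionN[/= h1 h2 h3] h4 h5]; rewrite !in_itv/=.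
  rewrite !in_itv/= => -[[[h1 h2] [h3 h4]] h5]; split => //.
  by apply/regionN.
apply: (subclosed_compact _ box); last by move=> z [].
apply: closedI; first by apply: compact_closed box; exact: norm_hausdorff.
apply: closed_comp => // z _; apply: continuous_comp; first exact: continuousG.
apply: continuous_pair => {}z.
- by apply: (@continuous_comp _ _ _ fst fst); exact: cvg_fst.
- by apply: (@continuous_comp _ _ _ snd fst); [exact: cvg_snd|exact: cvg_fst].
Qed.

Let sign_sqr (v w : R) : 0 < w -> v = w \/ v = - w -> (v / w) ^+ 2 = 1.
Proof.
by move=> w0 [->|->]; rewrite ?mulNr divff ?gt_eqF// ?sqrrN expr1n.
Qed.

Let mapsG w : B w -> A (G w).
Proof.
move=> [/regionN[h1 h2 h3] h4 h5]; split => //.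
- rewrite /H1 /energy/= exprMn sign_sqr// mul1r.
  exact: (orbit_energy hO1).
- rewrite /H2 /energy/= exprMn sign_sqr// mul1r.
  exact: (orbit_energy hO2).
Qed.

Let ontoG z : A z -> exists2 w, B w & G w = z.
Proof.
case: z => [[q1 p1] [q2 p2]] [/= hr h1 h2].
have [x1 [x10 q1E p1E]] := orbit_onto hO1 h1.
have [x2 [x20 q2E p2E]] := orbit_onto hO2 h2.
have sgn (p w P : R) : 0 < w -> p = P \/ p = - P ->
    exists2 v, v = w \/ v = - w & v / w * P = p.
  move=> w0 [->|->].
  - by exists w; [left|rewrite divff ?gt_eqF// mul1r].
  - by exists (- w); [right|rewrite mulNr divff ?gt_eqF// mulN1r].
have [v1 hv1 v1E] := sgn _ _ _ w10 p1E.
have [v2 hv2 v2E] := sgn _ _ _ w20 p2E.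
exists ((x1, v1), (x2, v2)).
  by split => //; apply/regionN; split => //=; rewrite -q1E -q2E.
by rewrite /G/= v1E v2E -q1E -q2E.
Qed.

Let sign_flip (v v' w P : R) : 0 < w -> v = w \/ v = - w -> v' = w \/ v' = - w ->
  v / w * P = v' / w * P -> P <> 0 -> v = v'.
Proof.
move=> w0 h h' e /eqP P0; move/(mulIf P0): e => /(congr1 ( *%R^~ w)).
by rewrite !divfK ?gt_eqF.
Qed.

Let either_sign (v v' w : R) : v = w \/ v = - w -> v' = w \/ v' = - w ->
  v = v' \/ v = - v'.
Proof.
by move=> [->|->] [->|->]; rewrite ?opprK; [left|right|right|left].
Qed.

(** At [0] and [pi] the table glues the two velocities, and there the momentum
    [P] vanishes; at the other sides the two gluings correspond. *)
Let impactG w w' : B w -> B w' -> (impact_rule N w w' <-> impact_rule M (G w) (G w')).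
Proof.
move: w w' => [[x1 v1] [x2 v2]] [[x1' v1'] [x2' v2']] [/= r hv1 hv2] [/= r' hv1' hv2'].
have [/= x10 x20 rM] := (regionN _).1 r; have [/= x10' x20' rM'] := (regionN _).1 r'.
have hv := vsidesN r; have hh := hsidesN r.
rewrite /position/= in r r' hv hh rM rM'.
split.
- move=> [/= pe h1 h2]; case: pe => e11 e22; subst x1' x2'.
  split => //=.
  + case: h1 => [->|[/hv [h|[h|h]] ->]]; first by left.
    * by left; rewrite h (orbit_P0 hO1) !mulr0.
    * by left; rewrite h (orbit_Ppi hO1) !mulr0.
    * by right; split => //; rewrite !mulNr.
  + case: h2 => [->|[/hh [h|[h|h]] ->]]; first by left.
    * by left; rewrite h (orbit_P0 hO2) !mulr0.
    * by left; rewrite h (orbit_Ppi hO2) !mulr0.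
    * by right; split => //; rewrite !mulNr.
- move=> [/= pe h1 h2]; case: pe => e11 e22.
  have {e11} e11 := orbit_Q_inj hO1 x10 x10' e11.
  have {e22} e22 := orbit_Q_inj hO2 x20 x20' e22.
  subst x1' x2'; rewrite /position/= in h1 h2; split => //=.
  + have [P0|P0] := pselect (P1 x1 = 0).
      have s : vsides N (x1, x2).
        by apply/hv; case: (orbit_P_eq0 hO1 x10 P0) => ->; [left|right; left].
      by case: (either_sign hv1 hv1') => h; [left|right].
    case: h1 => [h|[s h]]; first by left; exact: sign_flip h P0.
    right; split; first by apply/hv; right; right.
    apply: (@sign_flip v1 (- v1') w1 (P1 x1)) => //; last by rewrite !mulNr.
    by case: hv1' => ->; rewrite ?opprK; [right|left].
  + have [P0|P0] := pselect (P2 x2 = 0).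
      have s : hsides N (x1, x2).
        by apply/hh; case: (orbit_P_eq0 hO2 x20 P0) => ->; [left|right; left].
      by case: (either_sign hv2 hv2') => h; [left|right].
    case: h2 => [h|[s h]]; first by left; exact: sign_flip h P0.
    right; split; first by apply/hh; right; right.
    apply: (@sign_flip v2 (- v2') w2 (P2 x2)) => //; last by rewrite !mulNr.
    by case: hv2' => ->; rewrite ?opprK; [right|left].
Qed.

(** A straight flight on the table stays within one monotone branch of each
    oscillation, so its image is a single free motion. *)
Let freeN w t w' : B w -> free_motion N w t w' -> B w' /\ free_motion M (G w) t (G w').
Proof.
move=> [rw hv1 hv2] [t0 [q1 [p1 [q2 [p2 [[s1 s2] [ew ew'] reg side]]]]]].
move: potN => [e1N e2N]; rewrite e1N in s1; rewrite e2N in s2.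
have sol1 := hamiltonian_solution0 s1; have sol2 := hamiltonian_solution0 s2.
subst w w'; rewrite /= in hv1 hv2; split.
  split; first by apply: reg; rewrite t0 lexx.
  - by rewrite /= (sol1 t).2.
  - by rewrite /= (sol2 t).2.
split => //.
exists (fun s => Q1 (q1 0 + s * p1 0)), (fun s => p1 0 / w1 * P1 (q1 0 + s * p1 0)).
exists (fun s => Q2 (q2 0 + s * p2 0)), (fun s => p2 0 / w2 * P2 (q2 0 + s * p2 0)).
split.
- by split; [exact: (orbit_solution hO1)|exact: (orbit_solution hO2)].
- rewrite !mul0r !addr0; split => //.
  by rewrite /G/= (sol1 t).1 (sol1 t).2 (sol2 t).1 (sol2 t).2.
- by move=> s /reg; rewrite (sol1 s).1 (sol2 s).1 => /regionN[].
- move=> s st; have := side s st.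
  have {}reg : region N (q1 s, q2 s).
    by apply: reg; case/andP: st => a b; rewrite !ltW.
  rewrite (sol1 s).1 (sol2 s).1 in reg *; apply: contra_not => -[[h|h]|h].
  + by left; left; apply/(vsidesN reg); right; right.
  + by left; right; apply/(hsidesN reg); right; right.
  + by right; apply/(stopsN reg).
Qed.

Let flowN w t w' : B w -> impact_flow N w t w' -> B w' /\ impact_flow M (G w) t (G w').
Proof.
move=> Bw f; elim: f Bw => [{}w {}t {}w' fm Bw|{}w {}t x1 x2 s {}w' _ IH ns r fm Bw].
  by have [Bw' fm'] := freeN Bw fm; split => //; exact: flow_free.
have [Bx1 f1] := IH Bw.
have Bx2 := saturatedB Bx1 r.
have [Bw' fm'] := freeN Bx2 fm; split => //.
apply: (@flow_impact _ M _ _ (G x1) (G x2)) => //; last exact/impactG.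
by have [rx _ _] := Bx1; move/(stopsN rx).
Qed.

(** A free motion can pass through turning points, where the table has an
    impact.  It is cut at the multiples of [pi] of the first phase, then each
    piece at those of the second phase, and the pieces are joined by the impact
    rule of the table. *)
Let freeM z t z' : A z -> free_motion M z t z' ->
  exists w w', [/\ B w, B w', G w = z, G w' = z' & impact_flow N w t w'].
Proof.
move=> [rz ez1 ez2] [t0 [q1 [p1 [q2 [p2 [[s1 s2] [ez ez'] reg side]]]]]].
subst z z'.
have [a1 a1pi sol1] := orbit_solution_angle hV1 hO1 s1 ez1.
have [a2 a2pi sol2] := orbit_solution_angle hV2 hO2 s2 ez2.
pose Z s : phase R := ((q1 s, p1 s), (q2 s, p2 s)).
pose S s s' := 0 <= s -> s' <= t ->
  exists w w', [/\ B w, B w', G w = Z s, G w' = Z s' & impact_flow N w (s' - s) w'].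
suff : S 0 t by move=> /(_ (lexx _) (lexx _)); rewrite subr0.
have concat s u s' : s < u -> u < s' -> S s u -> S u s' -> S s s'.
  move=> su us' S1 S2 s0 s't.
  have u0 : 0 < u by exact: le_lt_trans su.
  have ut : u < t by exact: lt_le_trans us' _.
  have [w [x [Bw Bx Gw Gx f1]]] := S1 s0 (ltW ut).
  have [y [w' [By Bw' Gy Gw' f2]]] := S2 (ltW u0) s't.
  exists w, w'; split => //.
  rewrite -(subrKA u s' (- s)) addrC; apply: (impact_flow_trans f1 _ _ f2).
    have [rx _ _] := Bx; move/(stopsN rx) => h.
    by apply: (side u); [rewrite u0 ut|right; move: Gx h => [-> _ -> _]].
  by apply/impactG => //; rewrite Gx Gy; split => //; left.
have pi0 := pi_gt0 R.
have angle_in (w a : R) k s : 0 < w ->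
    ((- pi - a) / w + k%:R * (pi / w) <= s) = (- pi + k%:R * pi <= a + s * w).
  move=> w0; rewrite mulrA -mulrDl ler_pdivrMr//.
  by rewrite -[in RHS]lerBlDl; congr (_ <= _); ring.
have angle_in' (w a : R) k s : 0 < w ->
    (s <= (- pi - a) / w + k%:R * (pi / w)) = (a + s * w <= - pi + k%:R * pi).
  move=> w0; rewrite mulrA -mulrDl ler_pdivlMr//.
  by rewrite -[in RHS]lerBrDl; congr (_ <= _); ring.
have start (w a : R) : 0 < w -> - pi <= a -> (- pi - a) / w <= 0.
  by move=> w0 h; rewrite pmulr_lle0 ?invr_gt0//; lra.
apply: (@grid_induction _ _ (pi / w1) S _ _ concat 0 t (start w1 a1 w10 a1pi)) => //.
  by rewrite divr_gt0.
move=> k1 s s' h1 ss' h1' s0 s't; move: (s0) (s't).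
have start2 := le_trans (start w2 a2 w20 a2pi) s0.
suff : forall u u', s <= u -> u' <= s' -> (- pi - a2) / w2 <= u -> u <= u' -> S u u'.
  by apply; rewrite ?lexx.
move=> u u' su u's' uge uu'.
move: (su) (u's').
apply: (@grid_induction _ _ (pi / w2) (fun u u' => s <= u -> u' <= s' -> S u u') _ _ _ u u' uge uu').
- by rewrite divr_gt0.
- move=> k2 {su u's' uge uu'}{}u {}u' h2 uu' h2' su u's' u0 u't.
  have [x1 [v1 [hv1 fold1]]] := orbit_fold hO1 a1 k1.
  have [x2 [v2 [hv2 fold2]]] := orbit_fold hO2 a2 k2.
  pose X r : phase R := ((x1 + r * v1, v1), (x2 + r * v2, v2)).
  have GX r : 0 <= r -> G (X r) = Z r.
    move=> r0; have [qE pE] := sol1 _ r0; have [qE' pE'] := sol2 _ r0.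
    have [Q1E P1E _] := fold1 r; have [Q2E P2E _] := fold2 r.
    by rewrite /G/= /Z qE pE qE' pE' Q1E P1E Q2E P2E.
  have in1 r : u <= r <= u' -> 0 <= x1 + r * v1 <= pi.
    move=> /andP[ur ru']; have [_ _] := fold1 r; apply.
    + by rewrite -angle_in// (le_trans h1)// (le_trans su).
    + by rewrite -angle_in'// (le_trans ru')// (le_trans u's').
  have in2 r : u <= r <= u' -> 0 <= x2 + r * v2 <= pi.
    move=> /andP[ur ru']; have [_ _] := fold2 r; apply.
    + by rewrite -angle_in// (le_trans h2).
    + by rewrite -angle_in'// (le_trans ru').
  have BX r : u <= r <= u' -> B (X r).
    move=> h; split => //; apply/regionN; split => //=; [exact: in1|exact: in2|].
    have r0 : 0 <= r by case/andP: h => + _; exact: le_trans.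
    have [-> _ -> _] := GX r r0; apply: reg; rewrite r0/=.
    by case/andP: h => _ h; exact: le_trans h u't.
  exists (X u), (X u'); split.
  + by apply: BX; rewrite lexx.
  + by apply: BX; rewrite lexx uu'.
  + exact: GX.
  + by apply: GX; exact: le_trans uu'.
  + apply: flow_free; split; first by rewrite subr_ge0.
    exists (fun r => x1 + u * v1 + r * v1), (fun=> v1).
    exists (fun r => x2 + u * v2 + r * v2), (fun=> v2).
    have shift x v r : x + u * v + r * v = x + (u + r) * v by ring.
    split.
    * by move: potN => [-> ->]; split; exact: hamiltonian_solution0_affine.
    * by rewrite !shift addr0 (addrC u) subrK.
    * move=> r /andP[r0 ru]; rewrite !shift.
      have h : u <= u + r <= u' by rewrite lerDl r0 -lerBrDl.
      by have [] := BX _ h.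
    * move=> r /andP[r0 ru]; rewrite !shift.
      have ur : u < u + r by rewrite ltrDl.
      have ru' : u + r < u' by rewrite -ltrBrDl.
      have h : u <= u + r <= u' by rewrite !ltW.
      have h0 : 0 < u + r by exact: le_lt_trans ur.
      have [rX _ _] := BX _ h; rewrite /position/= in rX.
      have v10 : v1 != 0 by case: hv1 => ->; rewrite ?oppr_eq0 gt_eqF.
      have v20 : v2 != 0 by case: hv2 => ->; rewrite ?oppr_eq0 gt_eqF.
      have /andP[x1l x1r] : 0 < x1 + (u + r) * v1 < pi.
        by apply: (@affine_interior _ _ _ _ u _ u') => //; apply: in1; rewrite lexx uu'.
      have /andP[x2l x2r] : 0 < x2 + (u + r) * v2 < pi.
        by apply: (@affine_interior _ _ _ _ u _ u') => //; apply: in2; rewrite lexx uu'.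
      have noside := side (u + r); rewrite h0 (lt_le_trans ru' u't) in noside.
      have [E1 _ E2 _] := GX _ (ltW h0).
      move=> [[/(vsidesN rX)/=|/(hsidesN rX)/=]|/(stopsN rX)/=].
      -- move=> [h3|[h3|h3]]; first by rewrite h3 ltxx in x1l.
           by rewrite h3 ltxx in x1r.
         by apply: noside => //; left; left; rewrite -E1 -E2.
      -- move=> [h3|[h3|h3]]; first by rewrite h3 ltxx in x2l.
           by rewrite h3 ltxx in x2r.
         by apply: noside => //; left; right; rewrite -E1 -E2.
      -- by move=> h3; apply: noside => //; right; rewrite -E1 -E2.
- move=> r1 r2 r3 r12 r23 S1 S2 h3 h4; apply: (concat _ r2) => //.
  + by apply: S1 => //; rewrite (le_trans (ltW r23)).
  + by apply: S2 => //; rewrite (le_trans h3)// ltW.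
Qed.

Let flowM z t z' : A z -> impact_flow M z t z' ->
  exists w w', [/\ B w, B w', G w = z, G w' = z' & impact_flow N w t w'].
Proof.
move=> Az f; elim: f Az => [{}z {}t {}z' fm Az|{}z {}t z1 z2 s {}z' _ IH ns r fm Az].
  exact: freeM fm.
have [w [x1 [Bw Bx1 Gw Gx1 f1]]] := IH Az.
have Az2 : A z2 by apply: saturatedA r; rewrite -Gx1; exact: mapsG.
have [x2 [w' [Bx2 Bw' Gx2 Gw' f2]]] := freeM Az2 fm.
exists w, w'; split => //; apply: (impact_flow_trans f1 _ _ f2).
  by have [rx _ _] := Bx1; move/(stopsN rx) => h; apply: ns; rewrite -Gx1.
by apply/impactG => //; rewrite Gx1 Gx2.
Qed.

(** [N] is the table obtained from [M] in the folded phases: its sides are the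
    images of the sides of [M] together with the turning points. *)
Lemma level_set_straightening : conjugate_to_directional_billiard
  (level_set M (H1 (pot1 M)) (H2 (pot2 M)) e1 e2) (glued_flow M) N w1 w2.
Proof. exact: (@conjugate_of_lift _ _ _ A B G). Qed.

End Straightening.

(** * The tables of the step system *)

Section StepTables.
Context {R : realType} (V1 V2 : R -> R) (q1w q2w e1 e2 w1 w2 : R) (Q1 P1 Q2 P2 : R -> R).
Hypothesis hV1 : confining_potential V1.
Hypothesis hV2 : confining_potential V2.
Hypothesis hO1 : angle_orbit V1 e1 w1 Q1 P1.
Hypothesis hO2 : angle_orbit V2 e2 w2 Q2 P2.
Local Notation M := (step_system V1 V2 q1w q2w).
Local Notation conjugate_to N := (conjugate_to_directional_billiard
  (step_level_set V1 V2 q1w q2w e1 e2) (step_flow V1 V2 q1w q2w) N w1 w2).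
Let pi0 : 0 < (pi : R) := pi_gt0 R.

Lemma closed_step_region : closed (~` step q1w q2w).
Proof.
rewrite closedC; have -> : step q1w q2w = [set q | q.1 < q1w] `&` [set q | q.2 < q2w] by [].
apply: openI.
- apply: (@open_comp _ _ fst [set x | x < q1w]); last exact: open_lt.
  by move=> z _; exact: cvg_fst.
- apply: (@open_comp _ _ snd [set x | x < q2w]); last exact: open_lt.
  by move=> z _; exact: cvg_snd.
Qed.

Lemma step_outside (q1 q2 : R) : region M (q1, q2) = (q1w <= q1 \/ q2w <= q2).
Proof.
apply/propext; rewrite /= /step/=; split.
- move=> h; have [|h1] := leP q1w q1; first by left.
  by have [|h2] := leP q2w q2; [right|case: h].
- by move=> [h|h] [h1 h2]; [rewrite leNgt h1 in h|rewrite leNgt h2 in h].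
Qed.

Lemma L_table (a b : R) : 0 < a < pi -> 0 < b < pi -> Q1 a = q1w -> Q2 b = q2w ->
  conjugate_to (L_billiard a b).
Proof.
move=> /andP[a0 ap] /andP[b0 bp] Qa Qb.
have ha : 0 <= a <= pi by rewrite !ltW.
have hb : 0 <= b <= pi by rewrite !ltW.
apply: (@level_set_straightening _ M _ _ _ _ _ _ _ _ _ hV1 hV2 hO1 hO2) => //.
- exact: closed_step_region.
- move=> [x1 x2]; rewrite step_outside /=; split => -[h1 h2 h3]; split => //.
  + by rewrite -Qa -Qb (orbit_Q_le hO1) ?(orbit_Q_le hO2).
  + by move: h3; rewrite -Qa -Qb (orbit_Q_le hO1) ?(orbit_Q_le hO2).
- move=> [x1 x2] [/= h1 h2 _]; rewrite -Qa -Qb (orbit_Q_le hO2)//.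
  split => [[->|->|[-> ?]]|[->|[->|[/(orbit_Q_inj hO1)-> // ?]]]];
    by [left|right; left|right; right|constructor 1|constructor 2|constructor 3].
- move=> [x1 x2] [/= h1 h2 _]; rewrite -Qa -Qb (orbit_Q_le hO1)//.
  split => [[->|->|[-> ?]]|[->|[->|[? /(orbit_Q_inj hO2)-> //]]]];
    by [left|right; left|right; right|constructor 1|constructor 2|constructor 3].
- move=> [x1 x2] [/= h1 h2 _]; rewrite -Qa -Qb; split => [[-> ->]//|[e11 e22]].
  by congr pair; [exact: (orbit_Q_inj hO1)|exact: (orbit_Q_inj hO2)].
Qed.

Lemma full_table :
  (forall x1 x2, q1w < Q1 x1 \/ q2w < Q2 x2) -> conjugate_to (rectangular_billiard pi pi).
Proof.
move=> avoid; apply: (@level_set_straightening _ M _ _ _ _ _ _ _ _ _ hV1 hV2 hO1 hO2) => //.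
- exact: closed_step_region.
- move=> [x1 x2]; rewrite step_outside /=; split => [[h1 h2]|[h1 h2 _]] //; split => //.
  by case: (avoid x1 x2) => /ltW; [left|right].
- move=> [x1 x2] _ /=; split; first by move=> [->|->]; [left|right; left].
  move=> [->|[->|[h1 h2]]]; [by left|by right|].
  by case: (avoid x1 x2); rewrite ?h1 ?ltxx// ltNge h2.
- move=> [x1 x2] _ /=; split; first by move=> [->|->]; [left|right; left].
  move=> [->|[->|[h1 h2]]]; [by left|by right|].
  by case: (avoid x1 x2); rewrite ?h2 ?ltxx// ltNge h1.
- move=> [x1 x2] _ /=; split => // -[h1 h2].
  by case: (avoid x1 x2); rewrite ?h1 ?h2 ltxx.
Qed.

Lemma floor_table (b : R) : (forall x, Q1 x < q1w) -> 0 < b < pi -> Q2 b = q2w ->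
  conjugate_to (rectangular_billiard pi b).
Proof.
move=> under /andP[b0 bp] Qb; have hb : 0 <= b <= pi by rewrite !ltW.
have le_pi (x : R) : 0 <= x <= b -> 0 <= x <= pi.
  by move=> /andP[-> h]; exact: le_trans h (ltW bp).
apply: (@level_set_straightening _ M _ _ _ _ _ _ _ _ _ hV1 hV2 hO1 hO2) => //.
- exact: closed_step_region.
- move=> [x1 x2]; rewrite step_outside /= (leNgt q1w) under -Qb; split.
    move=> [h1 h2]; split => //; [exact: le_pi|right].
    by rewrite (orbit_Q_le hO2)// ?le_pi//; case/andP: h2.
  move=> [h1 h2 [//|]]; rewrite (orbit_Q_le hO2)// => h3.
  by rewrite h3 andbT; case/andP: h2.
- move=> [x1 x2] _ /=; split; first by move=> [->|->]; [left|right; left].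
  move=> [->|[->|[h1 h2]]]; [by left|by right|].
  by have := under x1; rewrite h1 ltxx.
- move=> [x1 x2] [/= h1 h2]; split.
    move=> [->|->]; first by left.
    by right; right; rewrite Qb; split => //; exact: ltW.
  move=> [->|[h|[_ h]]]; first by left.
    by case/andP: h2 => _; rewrite h leNgt bp.
  by right; exact: (orbit_Q_inj hO2 (le_pi _ h2) hb (etrans h (esym Qb))).
- move=> [x1 x2] _ /=; split => // -[h1 h2].
  by have := under x1; rewrite h1 ltxx.
Qed.

Lemma side_table (a : R) : (forall x, Q2 x < q2w) -> 0 < a < pi -> Q1 a = q1w ->
  conjugate_to (rectangular_billiard a pi).
Proof.
move=> under /andP[a0 ap] Qa; have ha : 0 <= a <= pi by rewrite !ltW.
have le_pi (x : R) : 0 <= x <= a -> 0 <= x <= pi.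
  by move=> /andP[-> h]; exact: le_trans h (ltW ap).
apply: (@level_set_straightening _ M _ _ _ _ _ _ _ _ _ hV1 hV2 hO1 hO2) => //.
- exact: closed_step_region.
- move=> [x1 x2]; rewrite step_outside /= (leNgt q2w) under -Qa; split.
    move=> [h1 h2]; split => //; [exact: le_pi|left].
    by rewrite (orbit_Q_le hO1)// ?le_pi//; case/andP: h1.
  move=> [h1 h2 [|//]]; rewrite (orbit_Q_le hO1)// => h3.
  by rewrite h3 andbT; case/andP: h1.
- move=> [x1 x2] [/= h1 h2]; split.
    move=> [->|->]; first by left.
    by right; right; rewrite Qa; split => //; exact: ltW.
  move=> [->|[h|[h _]]]; first by left.
    by case/andP: h1 => _; rewrite h leNgt ap.
  by right; exact: (orbit_Q_inj hO1 (le_pi _ h1) ha (etrans h (esym Qa))).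
- move=> [x1 x2] _ /=; split; first by move=> [->|->]; [left|right; left].
  move=> [->|[->|[h1 h2]]]; [by left|by right|].
  by have := under x2; rewrite h2 ltxx.
- move=> [x1 x2] _ /=; split => // -[h1 h2].
  by have := under x2; rewrite h2 ltxx.
Qed.

End StepTables.

(** * Positive area of the allowed positions *)

Section Area.
Context {R : realType}.
Local Notation mu := (@lebesgue_measure R).

Lemma sublevel_right_interval (V : R -> R) (lo e : R) : continuous V -> V lo < e ->
  exists2 hi, lo < hi & forall x, lo < x < hi -> V x <= e.
Proof.
move=> cV Ve.
have /nbhs_ballP[d /= d0 hd] : \forall x \near lo, V x < e.
  by apply: (cvgr_lt _ (cV lo)).
exists (lo + d); first by rewrite ltrDl.
move=> x /andP[lx xd]; apply/ltW/hd.
by rewrite /ball/= ltr0_norm ?subr_lt0//; lra.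
Qed.

Lemma allowed_position (V1 V2 : R -> R) (q1w q2w e1 e2 : R) :
  [set position z | z in [set z | [/\ (~` step q1w q2w) (position z),
                                      H1 V1 z = e1 & H2 V2 z = e2]]] =
  ((V1 @^-1` `]-oo, e1]) `*` (V2 @^-1` `]-oo, e2])) `&`
  ((`[q1w, +oo[ `*` setT) `|` (setT `*` `[q2w, +oo[)).
Proof.
apply/seteqP; split => [_ [[[q1 p1] [q2 p2]] [hs h1 h2] <-]|[q1 q2]] /=.
- rewrite /position/= in hs *; move: h1 h2; rewrite /H1 /H2 /energy/= => h1 h2.
  split; first by split; rewrite in_itv/= -?h1 -?h2 lerDr mulr_ge0// sqr_ge0.
  rewrite !in_itv/= !andbT; have [|h3] := leP q1w q1; first by left.
  have [|h4] := leP q2w q2; first by right.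
  by case: hs.
- rewrite !in_itv/= !andbT => -[[h1 h2] h3].
  exists ((q1, Num.sqrt (2 * (e1 - V1 q1))), (q2, Num.sqrt (2 * (e2 - V2 q2)))) => //.
  rewrite /H1 /H2 /energy/= !sqr_sqrtr ?mulr_ge0 ?subr_ge0//; split.
  + move=> [/= h4 h5]; case: h3 => -[h6 h7].
    * by rewrite leNgt h4 in h6.
    * by rewrite leNgt h5 in h7.
  + by field.
  + by field.
Qed.

Lemma measurable_allowed_position (V1 V2 : R -> R) (q1w q2w e1 e2 : R) :
  continuous V1 -> continuous V2 ->
  measurable (((V1 @^-1` `]-oo, e1]) `*` (V2 @^-1` `]-oo, e2])) `&`
  ((`[q1w, +oo[ `*` setT) `|` (setT `*` `[q2w, +oo[)) : set (R * R)).
Proof.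
move=> c1 c2.
have pre (V : R -> R) e : continuous V -> measurable (V @^-1` `]-oo, e]).
  move=> cV; rewrite -[X in measurable X]setTI.
  by apply: continuous_measurable_fun => //; exact: measurable_itv.
apply: measurableI; first by apply: measurableX; exact: pre.
by apply: measurableU; apply: measurableX => //; exact: measurable_itv.
Qed.

(** If [V1 q1w < e1], the region contains the rectangle just to the right of
    [max 0 q1w] in [q1] and just to the right of [0] in [q2]; starting at
    [max 0 q1w] instead of [q1w] is possible as [V1] is at most [V1 q1w]
    there. *)
Lemma allowed_area_gt0 (V1 V2 : R -> R) (q1w q2w e1 e2 : R) :
  confining_potential V1 -> confining_potential V2 -> 0 < e1 -> 0 < e2 ->
  V1 q1w < e1 \/ V2 q2w < e2 -> (0 < allowed_area V1 V2 q1w q2w e1 e2)%E.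
Proof.
move=> hV1 hV2 e10 e20 he.
have c1 := potential_continuous hV1; have c2 := potential_continuous hV2.
have right_of (V : R -> R) (qw e : R) : confining_potential V -> 0 < e -> V qw < e ->
    V (Num.max 0 qw) < e.
  by move=> hV e0 h; case: (leP 0 qw) => _ //; rewrite (potential0 hV).
suff [lo1 [hi1 [lo2 [hi2 [h1 h2 hS]]]]] : exists lo1 hi1 lo2 hi2, [/\ lo1 < hi1, lo2 < hi2 &
    (`]lo1, hi1[ `*` `]lo2, hi2[)%classic `<=`
    ((V1 @^-1` `]-oo, e1]) `*` (V2 @^-1` `]-oo, e2])) `&`
    ((`[q1w, +oo[ `*` setT) `|` (setT `*` `[q2w, +oo[))].
  rewrite /allowed_area allowed_position.
  have mI : measurable (`]lo1, hi1[ `*` `]lo2, hi2[ : set (R * R)).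
    by apply: measurableX; exact: measurable_itv.
  apply: lt_le_trans (_ : (mu \x mu)%E (`]lo1, hi1[ `*` `]lo2, hi2[) <= _)%E.
    rewrite product_measure1E//= !lebesgue_measure_itv/= !lte_fin h1 h2.
    by rewrite -!EFinD -EFinM lte_fin mulr_gt0// subr_gt0.
  apply: le_measure; rewrite ?inE//; exact: measurable_allowed_position.
have V10 : V1 0 < e1 by rewrite (potential0 hV1).
have V20 : V2 0 < e2 by rewrite (potential0 hV2).
case: he => he.
- have [hi1 h1 hS1] := sublevel_right_interval c1 (right_of _ _ _ hV1 e10 he).
  have [hi2 h2 hS2] := sublevel_right_interval c2 V20.
  exists (Num.max 0 q1w), hi1, 0, hi2; split => // -[x1 x2] /= [].
  rewrite !in_itv/= => x1in x2in; split; first by split; [exact: hS1|exact: hS2].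
  left; split => //; rewrite andbT; case/andP: x1in => + _; rewrite gt_max.
  by move=> /andP[_ /ltW].
- have [hi1 h1 hS1] := sublevel_right_interval c1 V10.
  have [hi2 h2 hS2] := sublevel_right_interval c2 (right_of _ _ _ hV2 e20 he).
  exists 0, hi1, (Num.max 0 q2w), hi2; split => // -[x1 x2] /= [].
  rewrite !in_itv/= => x1in x2in; split; first by split; [exact: hS1|exact: hS2].
  right; split => //; rewrite andbT; case/andP: x2in => + _; rewrite gt_max.
  by move=> /andP[_ /ltW].
Qed.

End Area.

(** * Non-integrability at the corner *)

Section Differentials.
Context {R : realType}.

Lemma derive_along (F : phase R -> R) (z v : phase R) (d : R) :
  is_derive (0 : R) (1 : R) (fun h => F (h *: v + z)) d -> 'D_v F z = d.
Proof.
move=> [_ <-]; rewrite /derive; congr (lim _).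
have -> // : (fun h : R => h^-1 *: ((F \o shift z) (h *: v) - F z)) =
  (fun h => h^-1 *: (((fun h => F (h *: v + z)) \o shift 0) (h *: 1) - F (0 *: v + z))).
by apply/funext => h /=; rewrite addr0 scale0r add0r /GRing.scale/= mulr1.
Qed.

Lemma differentiable_energy (V : R -> R) (z : R * R) :
  confining_potential V -> differentiable (energy V) z.
Proof.
move=> hV.
have dfst : differentiable (fst : R * R -> R) z.
  by apply: linear_differentiable => x; exact: cvg_fst.
have dsnd : differentiable (snd : R * R -> R) z.
  by apply: linear_differentiable => x; exact: cvg_snd.
have dV : differentiable (V \o fst) z.
  apply: differentiable_comp => //; apply/derivable1_diffP.
  by case: (potential_is_derive hV z.1).
have dp : differentiable (fun z : R * R => z.2 ^+ 2 / 2) z.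
  apply: differentiableM; last exact: differentiable_cst.
  rewrite (_ : (fun x => x.2 ^+ 2) = (fun x => x.2 * x.2)); first exact: differentiableM.
  by apply/funext => x; rewrite expr2.
exact: differentiableD.
Qed.

Lemma energy_is_derive_line (V : R -> R) (x v : R * R) : confining_potential V ->
  is_derive (0 : R) (1 : R) (fun h => energy V (h *: v + x))
    (v.2 * x.2 + v.1 * derive1 V x.1).
Proof.
move=> hV; rewrite /energy/= /GRing.scale/=.
have h1 : is_derive (0 : R) (1 : R) (fun h => h * v.1 + x.1) v.1.
  by apply: is_derive_eq; rewrite /GRing.scale/=; ring.
have hV1 : is_derive (0 * v.1 + x.1) (1 : R) V (derive1 V x.1).
  by rewrite mul0r add0r; exact: potential_is_derive.
have h2 := @is_derive1_comp _ V (fun h => h * v.1 + x.1) 0 _ _ hV1 h1.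
have h3 : is_derive (0 : R) (1 : R) (fun h => (h * v.2 + x.2) ^+ 2 / 2) (v.2 * x.2).
  by apply: is_derive_eq; rewrite /GRing.scale/=; field.
by have := is_deriveD h3 h2; rewrite [derive1 V x.1 * _]mulrC.
Qed.

Lemma diff_H1 (V : R -> R) (z v : phase R) : confining_potential V ->
  'd (H1 V) z v = v.1.2 * z.1.2 + v.1.1 * derive1 V z.1.1.
Proof.
move=> hV; rewrite -deriveE; last first.
  apply: (@differentiable_comp _ _ _ _ fst (energy V)); last exact: differentiable_energy.
  by apply: linear_differentiable => x; exact: cvg_fst.
by apply: derive_along; exact: energy_is_derive_line.
Qed.

Lemma diff_H2 (V : R -> R) (z v : phase R) : confining_potential V ->
  'd (H2 V) z v = v.2.2 * z.2.2 + v.2.1 * derive1 V z.2.1.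
Proof.
move=> hV; rewrite -deriveE; last first.
  apply: (@differentiable_comp _ _ _ _ snd (energy V)); last exact: differentiable_energy.
  by apply: linear_differentiable => x; exact: cvg_snd.
by apply: derive_along; exact: energy_is_derive_line.
Qed.

(** The differential of the energy vanishes only at the minimum with zero
    momentum, where the energy is zero. *)
Lemma regular_energy (V : R -> R) (x : R * R) (c : R) : confining_potential V ->
  0 < energy V x -> (forall v : R * R, c * (v.2 * x.2 + v.1 * derive1 V x.1) = 0) -> c = 0.
Proof.
move=> hV e0 h; have [p0|p0] := eqVneq x.2 0.
  have q0 : x.1 != 0.
    apply/negP => /eqP q0; move: e0.
    by rewrite /energy p0 q0 (potential0 hV) expr0n mul0r addr0 ltxx.
  have dV0 : derive1 V x.1 != 0.
    have [/(force_lt0 hV)/lt_eqF->//|/(force_gt0 hV)/gt_eqF->//|e] := ltgtP x.1 0.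
    by rewrite e eqxx in q0.
  by have := h (1, 0); rewrite /= mul0r add0r mul1r => /eqP; rewrite mulf_eq0 (negPf dV0) orbF => /eqP.
by have := h (0, 1); rewrite /= mul0r addr0 mul1r => /eqP; rewrite mulf_eq0 (negPf p0) orbF => /eqP.
Qed.

Lemma independent_energies (V1 V2 : R -> R) (z : phase R) :
  confining_potential V1 -> confining_potential V2 ->
  0 < H1 V1 z -> 0 < H2 V2 z -> independent_differentials (H1 V1) (H2 V2) z.
Proof.
move=> hV1 hV2 h1 h2 a b h; split.
- apply: (regular_energy hV1 h1) => v; have := h (v, (0, 0)).
  by rewrite diff_H1// diff_H2//= !mul0r addr0 mulr0 addr0.
- apply: (regular_energy hV2 h2) => v; have := h ((0, 0), v).
  by rewrite diff_H1// diff_H2//= !mul0r addr0 mulr0 add0r.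
Qed.

Lemma directed_motion_deterministic (w1 w2 : R) u t u1 u2 :
  directed_motion w1 w2 u t u1 -> directed_motion w1 w2 u t u2 -> u1 = u2.
Proof.
move=> [_ [a [-> ->]]] [_ [b [[c1 s1 c2 s2] ->]]].
by rewrite /torus_point/= !cosD !sinD c1 s1 c2 s2.
Qed.

End Differentials.

Section Corner.
Context {R : realType} (V1 V2 : R -> R) (q1w q2w : R).
Hypothesis hV1 : confining_potential V1.
Hypothesis hV2 : confining_potential V2.
Local Notation M := (step_system V1 V2 q1w q2w).

Lemma free_motion_component (e1 e2 t : R) (q1 p1 q2 p2 : R -> R) :
  hamiltonian_solution V1 q1 p1 -> hamiltonian_solution V2 q2 p2 ->
  energy V1 (q1 0, p1 0) = e1 -> energy V2 (q2 0, p2 0) = e2 -> 0 <= t ->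
  (forall s, 0 <= s <= t -> region M (q1 s, q2 s)) ->
  connected_component (level_set M (H1 V1) (H2 V2) e1 e2)
    (to_glued M ((q1 0, p1 0), (q2 0, p2 0))) (to_glued M ((q1 t, p1 t), (q2 t, p2 t))).
Proof.
move=> s1 s2 h1 h2 t0 reg.
pose c s := to_glued M ((q1 s, p1 s), (q2 s, p2 s)).
apply: (@connected_component_max _ _ (c @` `[0, t])).
- by exists 0; rewrite //= in_itv/= lexx.
- move=> _ [s + <-]; rewrite /= in_itv/= => st.
  exists ((q1 s, p1 s), (q2 s, p2 s)) => //; split; first exact: reg.
  + by rewrite -h1; exact: (hamiltonian_energy hV1).
  + by rewrite -h2; exact: (hamiltonian_energy hV2).
- apply: connected_continuous_connected; first exact: segment_connected.
  apply: continuous_subspaceT => s.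
  apply: (@continuous_comp _ _ _ (fun s => ((q1 s, p1 s), (q2 s, p2 s)) : phase R) (to_glued M));
    last exact: pi_continuous.
  apply: continuous_pair => {}s; apply: continuous_pair => {}s.
  + exact: is_derive_continuous (s1 s).1.
  + exact: is_derive_continuous (s1 s).2.
  + exact: is_derive_continuous (s2 s).1.
  + exact: is_derive_continuous (s2 s).2.
- by exists t; rewrite //= in_itv/= lexx t0.
Qed.

(** The corner [(q1w, q2w)] with both momenta of positive sign is glued to the
    corner with [p2] reversed.  Starting from either, [q1] grows beyond [q1w],
    so the motion remains outside the step, while [q2] grows in one case and
    decreases in the other. *)
Lemma corner_branches (e1 e2 : R) : V1 q1w < e1 -> V2 q2w < e2 ->
  exists c y1 y2 t, [/\ level_set M (H1 V1) (H2 V2) e1 e2 c,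
    connected_component (level_set M (H1 V1) (H2 V2) e1 e2) c y1,
    connected_component (level_set M (H1 V1) (H2 V2) e1 e2) c y2,
    glued_flow M c t y1 /\ glued_flow M c t y2 & y1 <> y2].
Proof.
move=> he1 he2.
have e10 : 0 < e1 by exact: le_lt_trans (potential_ge0 hV1 q1w) he1.
have e20 : 0 < e2 by exact: le_lt_trans (potential_ge0 hV2 q2w) he2.
have [w1 [Q1 [P1 hO1]]] := angle_orbit_exists hV1 e10.
have [w2 [Q2 [P2 hO2]]] := angle_orbit_exists hV2 e20.
have w10 := orbit_freq_gt0 hO1; have w20 := orbit_freq_gt0 hO2.
have [+ Qa] := orbit_theta_wall hV1 hO1 he1.
have [+ Qb] := orbit_theta_wall hV2 hO2 he2.
move: (theta_wall V1 q1w e1) (theta_wall V2 q2w e2) Qa Qb => a b Qa Qb /andP[b0 bp] /andP[a0 ap].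
(* Until time [t] both phases stay in [[0, pi]], in either direction of the
   second one. *)
pose t := Num.min (a / w1) (Num.min (b / w2) ((pi - b) / w2)).
have t0 : 0 < t by rewrite !lt_min !divr_gt0// subr_gt0.
have [ta tb tpb] : [/\ t * w1 <= a, t * w2 <= b & t * w2 <= pi - b].
  by split; rewrite -ler_pdivlMr// !ge_min lexx ?orbT.
have sol1 := orbit_solution (v := - w1) hO1 a (or_intror erefl).
have sol2 v (hv : v = w2 \/ v = - w2) := orbit_solution hO2 b hv.
have step1 s : 0 < s -> s <= t -> q1w < Q1 (a + s * - w1).
  move=> s0 st; rewrite -Qa; have s1 : 0 < s * w1 by rewrite mulr_gt0.
  have : s * w1 <= t * w1 by rewrite ler_pM2r.
  by move=> h; apply: (orbit_Q_decreasing hO1); rewrite ?mulrN; lra.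
have energy1 : energy V1 (Q1 (a + 0 * - w1), - w1 / w1 * P1 (a + 0 * - w1)) = e1.
  rewrite mul0r addr0 mulNr divff ?gt_eqF// mulN1r -(orbit_energy hO1 a).
  by rewrite /energy/= sqrrN.
have energy2 v : v = w2 \/ v = - w2 -> energy V2 (Q2 (b + 0 * v), v / w2 * P2 (b + 0 * v)) = e2.
  rewrite mul0r addr0 -(orbit_energy hO2 b) /energy/=.
  by case=> ->; rewrite ?mulNr divff ?gt_eqF// ?mulN1r ?mul1r ?sqrrN.
have reg v s : 0 <= s <= t -> region M (Q1 (a + s * - w1), Q2 (b + s * v)).
  rewrite le_eqVlt => /andP[/predU1P[<- _|s0 st]] [/=].
    by rewrite mul0r addr0 Qa ltxx.
  by rewrite ltNge ltW// step1.
pose Z v s : phase R := ((Q1 (a + s * - w1), - w1 / w1 * P1 (a + s * - w1)),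
                         (Q2 (b + s * v), v / w2 * P2 (b + s * v))).
have flow v : v = w2 \/ v = - w2 -> glued_flow M (to_glued M (Z v 0)) t (to_glued M (Z v t)).
  move=> hv; exists (Z v 0), (Z v t); split => //; apply: flow_free; split; first exact: ltW.
  exists (fun s => Q1 (a + s * - w1)), (fun s => - w1 / w1 * P1 (a + s * - w1)).
  exists (fun s => Q2 (b + s * v)), (fun s => v / w2 * P2 (b + s * v)); split => //.
  - by split => //; exact: sol2.
  - exact: reg.
  - move=> s /andP[s0 st] h; have := step1 s s0 (ltW st).
    case: h => [[[/= h _]|[/= h _]]|[h _]]; first by rewrite h ltxx.
    + by rewrite ltNge h.
    + by rewrite h ltxx.
have comp v : v = w2 \/ v = - w2 -> connected_component (level_set M (H1 V1) (H2 V2) e1 e2)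
    (to_glued M (Z v 0)) (to_glued M (Z v t)).
  move=> hv; apply: (@free_motion_component e1 e2 t (fun s => Q1 (a + s * - w1))
    (fun s => - w1 / w1 * P1 (a + s * - w1)) (fun s => Q2 (b + s * v))
    (fun s => v / w2 * P2 (b + s * v))) => //.
  - exact: sol2.
  - exact: energy2.
  - exact: ltW.
  - exact: reg.
have hw : w2 = w2 \/ w2 = - w2 by left.
have hNw : - w2 = w2 \/ - w2 = - w2 by right.
have same : to_glued M (Z (- w2) 0) = to_glued M (Z w2 0).
  apply/to_gluedP; split; rewrite /Z /position/= ?mul0r ?addr0//; first by left.
  by right; rewrite Qa Qb mulNr mulNr.
exists (to_glued M (Z w2 0)), (to_glued M (Z w2 t)), (to_glued M (Z (- w2) t)), t; split.
- exists (Z w2 0) => //; split; last exact: energy2.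
    by apply: reg; rewrite lexx ltW.
  exact: energy1.
- exact: comp.
- by rewrite -same; exact: comp.
- by split; [exact: flow|rewrite -same; exact: flow].
- move=> /to_gluedP[+ _ _]; rewrite /position/= => -[h].
  have s2 : 0 < t * w2 by rewrite mulr_gt0.
  have : Q2 (b + t * w2) < Q2 (b + t * - w2).
    by apply: (orbit_Q_decreasing hO2); rewrite ?mulrN; lra.
  by rewrite h ltxx.
Qed.

Lemma step_not_LIHIS : ~ LIHIS M (H1 V1) (H2 V2).
Proof.
move=> [respF respT]; pose e1 := V1 q1w + 1; pose e2 := V2 q2w + 1.
have he1 : V1 q1w < e1 by rewrite ltrDl.
have he2 : V2 q2w < e2 by rewrite ltrDl.
have [c [y1 [y2 [t [Lc C1 C2 [f1 f2] y12]]]]] := corner_branches he1 he2.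
have [z Cz|w1 [w2 [f [g [[fC gC] [fK gK] _ conj]]]]] := respT e1 e2 c Lc.
  have [z' [rz' E1 E2] /to_gluedP zz'] := connected_component_sub Cz.
  have [F1 F2] := respF _ _ rz' zz'.
  apply: independent_energies => //.
  - by rewrite -F1 E1; exact: le_lt_trans (potential_ge0 hV1 q1w) he1.
  - by rewrite -F2 E2; exact: le_lt_trans (potential_ge0 hV2 q2w) he2.
have Cc := connected_component_refl Lc.
apply: y12; rewrite -(fK y1) ?inE// -(fK y2) ?inE//; congr g.
have d1 := (conj c t y1 Cc C1).1 f1; have d2 := (conj c t y2 Cc C2).1 f2.
exact: directed_motion_deterministic d1 d2.
Qed.

End Corner.

Theorem theorem2p2 (R : realType) (V1 V2 : R -> R) (q1w q2w : R)
    (hV1 : confining_potential V1) (hV2 : confining_potential V2)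
    (hq : q1w * q2w != 0) :
  ~ LIHIS (step_system V1 V2 q1w q2w) (H1 V1) (H2 V2) /\
  (forall h : R, hstep V1 V2 q1w q2w < h ->
    [/\ forall e1 : R, Rc V1 V2 q1w q2w h e1 ->
          let a := theta_wall V1 q1w e1 in
          let b := theta_wall V2 q2w (h - e1) in
          [/\ 0 < a < pi, 0 < b < pi &
              conjugate_to_directional_billiard
                (step_level_set V1 V2 q1w q2w e1 (h - e1))
                (step_flow V1 V2 q1w q2w)
                (L_billiard a b) (omega V1 e1) (omega V2 (h - e1))],
        forall e1 : R, Rc_compl V1 V2 q1w q2w h e1 ->
          exists a b w1 w2 : R,
            [/\ 0 < a /\ 0 < b, 0 < w1 /\ 0 < w2 &
              conjugate_to_directional_billiard
                (step_level_set V1 V2 q1w q2w e1 (h - e1))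
                (step_flow V1 V2 q1w q2w)
                (rectangular_billiard a b) w1 w2]
      & positive_measure_family V1 V2 q1w q2w h (Rc V1 V2 q1w q2w h) /\
        positive_measure_family V1 V2 q1w q2w h (Rc_compl V1 V2 q1w q2w h)]).

Proof.
have /andP[q1n0 q2n0] : (q1w != 0) && (q2w != 0) by rewrite -negb_or -mulf_eq0.
have V1w : 0 < V1 q1w by exact: potential_gt0.
have V2w : 0 < V2 q2w by exact: potential_gt0.
split; first exact: step_not_LIHIS.
move=> h; rewrite /hstep /h1step /h2step => hh.
have Rc_energies e1 : Rc V1 V2 q1w q2w h e1 -> V1 q1w < e1 /\ V2 q2w < h - e1.
  by rewrite /Rc /h1step /h2step /= in_itv/= => /andP[? ?]; split; lra.
have Rc_compl_energies e1 : Rc_compl V1 V2 q1w q2w h e1 ->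
    (0 < e1 /\ 0 < h - e1) /\
    (e1 < V1 q1w /\ V2 q2w < h - e1 \/ V1 q1w < e1 /\ h - e1 < V2 q2w).
  rewrite /Rc_compl /h1step /h2step /= !in_itv/= => -[/andP[? ?]|/andP[? ?]].
    by split; [split|left; split]; lra.
  by split; [split|right; split]; lra.
split.
- move=> e1 /Rc_energies[he1 he2]; cbv zeta.
  have [w1 [Q1 [P1 hO1]]] := angle_orbit_exists hV1 (lt_trans V1w he1).
  have [w2 [Q2 [P2 hO2]]] := angle_orbit_exists hV2 (lt_trans V2w he2).
  have [ha Qa] := orbit_theta_wall hV1 hO1 he1.
  have [hb Qb] := orbit_theta_wall hV2 hO2 he2.
  split => //; rewrite (orbit_omega hV1 hO1) (orbit_omega hV2 hO2).
  exact: (L_table hV1 hV2 hO1 hO2).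
- move=> e1 /Rc_compl_energies[[e10 e20] he].
  have [w1 [Q1 [P1 hO1]]] := angle_orbit_exists hV1 e10.
  have [w2 [Q2 [P2 hO2]]] := angle_orbit_exists hV2 e20.
  have w10 := orbit_freq_gt0 hO1; have w20 := orbit_freq_gt0 hO2.
  have pi0 := pi_gt0 R.
  (* Only the coordinate whose energy is below its wall keeps to one side of it;
     the sign of that wall decides whether the step can be met. *)
  case: he => -[he1 he2].
  + have [q1lt|q1gt|q1e] := ltgtP q1w 0; last by rewrite q1e eqxx in q1n0.
      exists pi, pi, w1, w2; split => //.
      apply: (full_table hV1 hV2 hO1 hO2) => x1 x2; left.
      exact: (orbit_above_wall hV1 hO1).
    have [/[dup] hb /andP[b0 _] Qb] := orbit_theta_wall hV2 hO2 he2.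
    exists pi, (theta_wall V2 q2w (h - e1)), w1, w2; split => //.
    apply: (floor_table hV1 hV2 hO1 hO2) => //.
    exact: (orbit_below_wall hV1 hO1).
  + have [q2lt|q2gt|q2e] := ltgtP q2w 0; last by rewrite q2e eqxx in q2n0.
      exists pi, pi, w1, w2; split => //.
      apply: (full_table hV1 hV2 hO1 hO2) => x1 x2; right.
      exact: (orbit_above_wall hV2 hO2).
    have [/[dup] ha /andP[a0 _] Qa] := orbit_theta_wall hV1 hO1 he1.
    exists (theta_wall V1 q1w e1), pi, w1, w2; split => //.
    apply: (side_table hV1 hV2 hO1 hO2) => //.
    exact: (orbit_below_wall hV2 hO2).
- split; split.
  + rewrite /Rc /h1step /h2step lebesgue_measure_itv/= lte_fin ifT; last lra.
    by rewrite -EFinD lte_fin; lra.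
  + move=> e1 /Rc_energies[he1 he2]; apply: allowed_area_gt0 => //; last by left.
      exact: lt_trans he1.
    exact: lt_trans he2.
  + apply: (@lt_le_trans _ _ (lebesgue_measure `]0, (V1 q1w)[%classic)).
      by rewrite lebesgue_measure_itv/= lte_fin V1w -EFinD lte_fin subr0.
    apply: le_measure; rewrite ?inE.
    * exact: measurable_itv.
    * by apply: measurableU; exact: measurable_itv.
    * by move=> x; left.
  + move=> e1 /Rc_compl_energies[[e10 e20] he]; apply: allowed_area_gt0 => //.
    by case: he => -[? ?]; [right|left].
Qed.
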